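(* Let $\mathcal X$ be a symmetrically normed ideal of compact operators on a Hilbert space $\mathcal H$ such that $\Vert T\Vert_{\mathcal X}\asymp\big\Vert\{\sum_{j=1}^ns_j(T)\}_n\big\Vert_F$, where $F$ is a Banach sequence lattice such that the operator $S(\{a_n\}):=\{a_{n^2}\}$ is bounded on $F$. Let $T$ be a Volterra operator such that $T_{\mathcal J}\in\mathcal X$. Then $T_{\mathcal R}\in\mathcal X(\log^{-1})$, where the ideal $\mathcal X(\log^{-1})$ consists of all compact operators $U$ on $\mathcal H$ that satisfy $$\Vert U\Vert_{\mathcal X(\log^{-1})}:=\Big\Vert\Big\{\frac{1}{\log(en)}\sum_{j=1}^ns_j(U)\Big\}_n\Big\Vert_F<\infty .$$
   Context: $\mathcal H$ is a separable complex Hilbert space. For a compact operator $T$ on $\mathcal H$, $\{s_j(T)\}_{j\ge1}$ is the non-increasing sequence of its $s$-numbers (singular values). A Banach sequence lattice $F$ is a Banach lattice of sequences indexed by $n\in\mathbb N=\{1,2,\dots\}$ with coordinatewise order. A symmetrically normed ideal is a two-sided ideal of compact operators that is a Banach space under a norm depending only on the $s$-numbers (and symmetric in the sense of Gohberg–Krein). $\asymp$ means two-sided inequality with positive constants independent of $T$. A Volterra operator is a compact operator whose spectrum is $\{0\}$. $T_{\mathcal R}=\frac12(T+T^\ast)$ and $T_{\mathcal J}=\frac1{2i}(T-T^\ast)$ are the real and imaginary components of $T$. *)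

(* Defs.v *)
From HB Require Import structures.
From mathcomp Require Import all_boot all_order all_algebra.
From mathcomp Require Import sesquilinear.
From mathcomp Require Import complex.
From mathcomp Require Import all_classical all_reals all_analysis.

Set Implicit Arguments.
Unset Strict Implicit.
Unset Printing Implicit Defensive.

Import Order.TTheory GRing.Theory Num.Theory.
Import numFieldNormedType.Exports.

Local Open Scope classical_set_scope.
Local Open Scope ring_scope.

(* Mathematical sequences are indexed by n = 1, 2, ...; throughout, position
   [k : nat] of a Rocq sequence holds the term of index n = k.+1. *)

(* Norms of normed modules over [R[i]] take (real) values in [R[i]]. *)
Definition rnorm (R : realType) (V : normedModType R[i]) (x : V) : R :=
  complex.Re `|x|.

Section Operators.
Context (R : realType) (H : completeNormedModType R[i]).

Definition separable : Prop := exists2 D : set H, countable D & dense D.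

Definition bounded_op (T : H -> H) : Prop := linear T /\ continuous T.

Definition compact_op (T : H -> H) : Prop :=
  bounded_op T /\ precompact (T @` [set x | `|x| <= 1]).

Definition op_norm (T : H -> H) : R :=
  sup [set rnorm (T x) | x in [set x | `|x| <= 1]].

Definition resolvent_set (T : H -> H) : set R[i] :=
  [set z | exists2 S : H -> H, bounded_op S &
     (forall x, S (T x - z *: x) = x) /\ (forall x, T (S x) - z *: S x = x)].

Definition spectrum (T : H -> H) : set R[i] := ~` resolvent_set T.

Definition volterra (T : H -> H) : Prop :=
  compact_op T /\ spectrum T = [set 0].

Definition lin_indep (m : nat) (e : 'I_m -> H) : Prop :=
  forall c : 'I_m -> R[i], \sum_(i < m) c i *: e i = 0 -> forall i, c i = 0.

Context (ip : {dot H for (@Num.conj R[i])}).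

Definition hilbert : Prop := forall x, ip x x = `|x| ^+ 2.

(* Riesz representation makes the set below a singleton when [T] is bounded. *)
Definition adjoint (T : H -> H) (y : H) : H :=
  xget 0 [set z | forall x, ip (T x) y = ip x z].

Definition real_part (T : H -> H) (x : H) : H :=
  2^-1 *: (T x + adjoint T x).

Definition imag_part (T : H -> H) (x : H) : H :=
  (2 * 'i)^-1 *: (T x - adjoint T x).

(* [s] is the non-increasing sequence of the square roots of the eigenvalues of
   T^* T, each repeated according to its multiplicity: every mu > 0 occurs in
   [s] exactly dim ker (T^* T - mu^2) times.  If [T] has finite rank, the
   sequence ends with zeros.  A compact [T] has exactly one such sequence. *)
Definition is_snumbers (T : H -> H) (s : nat -> R) : Prop :=
  [/\ {homo s : j k / (j <= k)%N >-> k <= j},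
      forall j, 0 <= s j
    & forall (mu : R) (m : nat), 0 < mu ->
        (exists2 e : 'I_m -> H, lin_indep e &
           forall i, adjoint T (T (e i)) = real_complex R (mu ^+ 2) *: e i) <->
        (exists2 g : 'I_m -> nat, injective g & forall i, s (g i) = mu)].

Definition snumber (T : H -> H) : nat -> R :=
  xget (fun=> 0) [set s | is_snumbers T s].

(* The sequence n |-> s_1(T) + ... + s_n(T). *)
Definition ssum (T : H -> H) (k : nat) : R := \sum_(j < k.+1) snumber T j.

(* A symmetrically normed ideal is presented as a Banach space with a linear
   embedding into the operators on [H]; the ideal is the range of [sni_op].
   [sni_ideal] contains both the two-sided ideal property and the inequality
   ||A T B|| <= |A| ||T|| |B|; with [sni_rank1] these are the axioms of
   Gohberg and Krein for a symmetric norm. *)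
Record symm_normed_ideal := SymmNormedIdeal {
  sni_space : completeNormedModType R[i];
  sni_op : {linear sni_space -> (H -> H)};
  sni_inj : injective sni_op;
  sni_compact : forall t, compact_op (sni_op t);
  sni_ideal : forall (t : sni_space) (A B : H -> H),
    bounded_op A -> bounded_op B ->
    exists2 u, sni_op u = A \o sni_op t \o B &
      rnorm u <= op_norm A * rnorm t * op_norm B;
  sni_rank1 : forall (t : sni_space) (x y : H),
    sni_op t = (fun z => ip z x *: y) -> rnorm t = op_norm (sni_op t);
  sni_snumber : forall (t : sni_space) (T : H -> H),
    compact_op T -> snumber T = snumber (sni_op t) ->
    exists2 u, sni_op u = T & rnorm u = rnorm t
}.

Definition in_ideal (X : symm_normed_ideal) (T : H -> H) : Prop :=
  range (sni_op X) T.

End Operators.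

(* A Banach space of real sequences (presented with a linear embedding into the
   space of all sequences), solid for the coordinatewise order, with a monotone
   norm. *)
Record banach_seq_lattice (R : realType) := BanachSeqLattice {
  bsl_space : completeNormedModType R;
  bsl_seq : {linear bsl_space -> (nat -> R)};
  bsl_inj : injective bsl_seq;
  bsl_solid : forall (f : bsl_space) (a : nat -> R),
    (forall k, `|a k| <= `|bsl_seq f k|) ->
    exists2 g, bsl_seq g = a & `|g| <= `|f|
}.

Section SequenceLattice.
Context (R : realType) (F : banach_seq_lattice R).

(* The norm of [F] extended by +oo to the sequences that are not in [F]
   (the infimum is over a set with at most one element). *)
Definition seq_norm (a : nat -> R) : \bar R :=
  ereal_inf [set (`|f|)%:E | f in [set f : bsl_space F | bsl_seq F f = a]].

(* {a_n} |-> {a_(n^2)} *)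
Definition square_sampling (a : nat -> R) : nat -> R :=
  fun k => a ((k.+1 ^ 2).-1)%N.

Definition square_sampling_bounded : Prop :=
  exists C : R, forall f : bsl_space F,
    (seq_norm (square_sampling (bsl_seq F f)) <= (C * `|f|)%:E)%E.

Context (H : completeNormedModType R[i]) (ip : {dot H for (@Num.conj R[i])}).

Definition norm_equiv_ssum (X : symm_normed_ideal ip) : Prop :=
  exists c C : R, [/\ 0 < c, 0 < C & forall t : sni_space X,
    (c%:E * seq_norm (ssum ip (sni_op X t)) <= (rnorm t)%:E <=
     C%:E * seq_norm (ssum ip (sni_op X t)))%E].

Definition log_norm (U : H -> H) : \bar R :=
  seq_norm (fun k => (ln (expR 1 * k.+1%:R))^-1 * ssum ip U k).

Definition in_log_ideal (U : H -> H) : Prop :=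
  compact_op U /\ (log_norm U < +oo)%E.

End SequenceLattice.

(* Main.v *)
(** Let [U] and [J] be the real and imaginary parts of [T], so [U = T - iJ].

    Compress [T] to a finite-dimensional space that contains the first [n]
    eigenvectors [e] of [U] and almost contains the range of [T].  In a Schur
    basis of that space the compression is triangular, and its diagonal is as
    small as we like: it consists of approximate eigenvalues of [T], and [T] is
    compact without nonzero eigenvalues.  Up to this diagonal, [<U e, e>] is
    thus given by the strict triangular truncation of [J].  This replaces the
    chain of invariant subspaces of the classical theory.

    Expand [J] in its eigenvectors.  The truncation of a rank-one operator of
    norm one, paired with [n] orthonormal vectors, contributes O(log n): halve
    the interval of basis indices repeatedly at a median of the mass.  The part
    of [J] beyond its first [n^4] eigenvalues is estimated in Hilbert-Schmidt
    norm.  With [S_k = s_1(J) + ... + s_k(J)], this gives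
      s_1(U) + ... + s_n(U) <= C log(en) S_(n^4) + 2n (sum_(j > n^4) s_j(J)^2)^(1/2).
    Iterating the sampling operator at a fixed coordinate of [F] shows that
    [S_k] grows slower than [k^(1/4)], so the last term is bounded; and
    [S_(n^4)] is in [F] because sampling at squares is bounded on [F]. *)

Require Import Defs.
From HB Require Import structures.
From mathcomp Require Import all_boot all_order all_algebra.
From mathcomp Require Import sesquilinear.
From mathcomp Require Import complex.
From mathcomp Require Import all_classical all_reals all_analysis.
From mathcomp Require Import ring lra zify.

Set Implicit Arguments.
Unset Strict Implicit.
Unset Printing Implicit Defensive.

Import Order.TTheory GRing.Theory Num.Theory.
Import numFieldNormedType.Exports.

Local Open Scope classical_set_scope.
Local Open Scope ring_scope.
Local Open Scope complex_scope.

(** * Moduli and inner products *)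

Section ComplexModulus.
Context (R : realType).
Implicit Types (z w : R[i]) (r : R).

Definition modulus z : R := complex.Re `|z|.

Lemma normE z : `|z| = (modulus z)%:C.
Proof. by rewrite /modulus RRe_real // realE normr_ge0. Qed.

Lemma modulus_ge0 z : 0 <= modulus z.
Proof. by rewrite -lecR -normE normr_ge0. Qed.

Lemma modulusM z w : modulus (z * w) = modulus z * modulus w.
Proof. by apply: complexI; rewrite rmorphM /= -!normE normrM. Qed.

Lemma modulusD z w : modulus (z + w) <= modulus z + modulus w.
Proof. by rewrite -lecR rmorphD /= -!normE ler_normD. Qed.

Lemma modulusN z : modulus (- z) = modulus z.
Proof. by rewrite /modulus normrN. Qed.

Lemma modulus0 : modulus 0 = 0.
Proof. by rewrite /modulus normr0. Qed.

Lemma modulus1 : modulus 1 = 1.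
Proof. by rewrite /modulus normr1. Qed.

Lemma modulus_conj z : modulus (Num.conj z) = modulus z.
Proof. by rewrite /modulus norm_conjC. Qed.

Lemma modulus_real r : modulus r%:C = `|r|.
Proof. by rewrite /modulus normc_def /= expr0n /= addr0 sqrtr_sqr. Qed.

Lemma modulus_eq0 z : (modulus z == 0) = (z == 0).
Proof. by rewrite -(inj_eq (@complexI R)) -normE normr_eq0. Qed.

Lemma modulusK z : z * Num.conj z = (modulus z ^+ 2)%:C.
Proof. by rewrite -normCK normE rmorphXn. Qed.

Lemma modulus_i : modulus 'i%R = 1.
Proof. by rewrite /modulus normCi. Qed.

Lemma modulusV z : modulus z^-1 = (modulus z)^-1.
Proof. by apply: complexI; rewrite fmorphV /= -!normE normfV. Qed.

Lemma modulus_sum (I : Type) (s : seq I) (P : pred I) (f : I -> R[i]) :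
  modulus (\sum_(i <- s | P i) f i) <= \sum_(i <- s | P i) modulus (f i).
Proof.
elim/big_rec2: _ => [|i y x _ h]; first by rewrite modulus0.
exact: le_trans (modulusD _ _) (lerD _ h).
Qed.

Lemma conj_real r : Num.conj r%:C = r%:C :> R[i].
Proof. by apply: conj_Creal; rewrite complex_real. Qed.

End ComplexModulus.

Section HilbertBasics.
Context (R : realType) (H : completeNormedModType R[i]).
Context (ip : {dot H for (@Num.conj R[i])}).
Hypothesis hip : hilbert ip.
Implicit Types (x y z : H) (a : R[i]).

Lemma rnormE x : `|x| = (rnorm x)%:C.
Proof. by rewrite /rnorm RRe_real // realE normr_ge0. Qed.

Lemma rnorm_ge0 x : 0 <= rnorm x.
Proof. by rewrite -lecR -rnormE normr_ge0. Qed.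

Lemma rnorm_eq0 x : (rnorm x == 0) = (x == 0).
Proof. by rewrite -(inj_eq (@complexI R)) -rnormE normr_eq0. Qed.

Lemma rnorm0 : rnorm (0 : H) = 0.
Proof. by rewrite /rnorm normr0. Qed.

Lemma rnormZ a x : rnorm (a *: x) = modulus a * rnorm x.
Proof. apply: complexI; rewrite rmorphM /= -!rnormE -normE. exact: normrZ. Qed.

Lemma rnormD x y : rnorm (x + y) <= rnorm x + rnorm y.
Proof. by rewrite -lecR rmorphD /= -!rnormE ler_normD. Qed.

Lemma rnormN x : rnorm (- x) = rnorm x.
Proof. by rewrite /rnorm normrN. Qed.

Lemma rnormBC x y : rnorm (x - y) = rnorm (y - x).
Proof. by rewrite /rnorm distrC. Qed.

Lemma rnorm_sub_le x y z : rnorm (x - z) <= rnorm (x - y) + rnorm (y - z).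
Proof. by rewrite (le_trans _ (rnormD _ _)) // addrA subrK. Qed.

Lemma ipDl x y z : ip (x + y) z = ip x z + ip y z.
Proof. exact: linearDl. Qed.
Lemma ipDr x y z : ip x (y + z) = ip x y + ip x z.
Proof. exact: linearDr. Qed.
Lemma ipBl x y z : ip (x - y) z = ip x z - ip y z.
Proof. exact: linearBl. Qed.
Lemma ipBr x y z : ip x (y - z) = ip x y - ip x z.
Proof. exact: linearBr. Qed.
Lemma ipZl a x y : ip (a *: x) y = a * ip x y.
Proof. exact: linearZl_LR. Qed.
Lemma ipZr a x y : ip x (a *: y) = Num.conj a * ip x y.
Proof. exact: linearZr_LR. Qed.
Lemma ip0l x : ip 0 x = 0. Proof. exact: linear0l. Qed.
Lemma ip0r x : ip x 0 = 0. Proof. exact: linear0r. Qed.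

Lemma ipC x y : Num.conj (ip y x) = ip x y.
Proof. by rewrite (hermC ip x y) expr0 mul1r. Qed.

Lemma ip_suml (I : Type) (s : seq I) (P : pred I) (f : I -> H) y :
  ip (\sum_(i <- s | P i) f i) y = \sum_(i <- s | P i) ip (f i) y.
Proof. exact: linear_sumlz. Qed.

Lemma ip_sumr (I : Type) (s : seq I) (P : pred I) (f : I -> H) y :
  ip y (\sum_(i <- s | P i) f i) = \sum_(i <- s | P i) ip y (f i).
Proof. exact: linear_sumr. Qed.

Lemma ipxx x : ip x x = (rnorm x ^+ 2)%:C.
Proof. by rewrite hip rnormE rmorphXn. Qed.

Lemma ip_inj x y : (forall z, ip z x = ip z y) -> x = y.
Proof.
move=> h; apply/eqP; rewrite -subr_eq0 -rnorm_eq0 -sqrf_eq0.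
by rewrite -(inj_eq (@complexI R)) -ipxx ipBr h subrr.
Qed.

Lemma rnormD2 x y :
  rnorm (x + y) ^+ 2 = rnorm x ^+ 2 + rnorm y ^+ 2 + 2 * complex.Re (ip x y).
Proof.
apply: complexI; rewrite -ipxx ipDl !ipDr !ipxx [RHS]rmorphD.
rewrite [X in _ = _ + X]rmorphM [X in _ = X + _]rmorphD /=.
have -> : (complex.Re (ip x y))%:C = (ip x y + ip y x) / 2.
  by rewrite -(ipC y x) complexRe ReE.
have -> : 2%:C = 2 :> R[i] by rewrite rmorph_nat.
by field.
Qed.

Lemma rnormB2 x y :
  rnorm (x - y) ^+ 2 = rnorm x ^+ 2 + rnorm y ^+ 2 - 2 * complex.Re (ip x y).
Proof.
rewrite rnormD2 rnormN -[- y]scaleN1r ipZr rmorphN rmorph1 mulN1r.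
by rewrite raddfN /= mulrN.
Qed.

Lemma parallelogram x y :
  rnorm (x + y) ^+ 2 + rnorm (x - y) ^+ 2 = 2 * (rnorm x ^+ 2 + rnorm y ^+ 2).
Proof. by rewrite rnormD2 rnormB2; ring. Qed.

Lemma cauchy_schwarz x y : modulus (ip x y) <= rnorm x * rnorm y.
Proof.
have [->|y0] := eqVneq y 0; first by rewrite ip0r modulus0 rnorm0 mulr0.
have ny : 0 < rnorm y by rewrite lt_def rnorm_ge0 rnorm_eq0 y0.
set c := ip x y; pose t := (rnorm y ^+ 2)^-1.
have := rnormB2 x ((t%:C * c) *: y).
rewrite rnormZ modulusM modulus_real ipZr rmorphM /= conj_real -/c.
rewrite -[_ * _ * c]mulrA [Num.conj c * _]mulrC modulusK -rmorphM /= ger0_norm ?invr_ge0 ?exprn_ge0 ?rnorm_ge0 // => h.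
have : 0 <= rnorm x ^+ 2 - modulus c ^+ 2 / rnorm y ^+ 2.
  have := exprn_ge0 2 (rnorm_ge0 (x - (t%:C * c) *: y)).
  rewrite h /t; congr (0 <= _); field; exact: lt0r_neq0.
rewrite subr_ge0 ler_pdivrMr ?exprn_gt0 // -exprMn.
by rewrite ler_pXn2r // nnegrE ?mulr_ge0 ?rnorm_ge0 ?modulus_ge0.
Qed.

End HilbertBasics.

(** * Triangular truncation of rank-one kernels *)

Section TriangularTruncation.
Context (R : realType).

Lemma sum_cauchy_schwarz (I : Type) (s : seq I) (a b : I -> R) :
  (\sum_(i <- s) a i * b i) ^+ 2 <=
  (\sum_(i <- s) a i ^+ 2) * (\sum_(i <- s) b i ^+ 2).
Proof.
elim: s => [|i s]; first by rewrite !big_nil expr0n mul0r.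
rewrite !big_cons.
set S := \sum_(j <- s) a j * b j; set A := \sum_(j <- s) a j ^+ 2.
set B := \sum_(j <- s) b j ^+ 2; move=> SAB.
have A0 : 0 <= A by rewrite sumr_ge0 // => j _; rewrite sqr_ge0.
have B0 : 0 <= B by rewrite sumr_ge0 // => j _; rewrite sqr_ge0.
set u := a i; set v := b i.
(* The induction step lacks only this mixed term. Multiplied by [A], the difference of its sides is
   a square plus a nonnegative multiple of [A * B - S ^+ 2]. *)
suff cross : 2 * S * u * v <= A * v ^+ 2 + B * u ^+ 2 by nra.
have [A00|A00] := eqVneq A 0.
  have -> : S = 0.
    by apply/eqP; rewrite -sqrf_eq0 eq_le sqr_ge0 andbT (le_trans SAB) // A00 mul0r.
  by rewrite mulr0 !mul0r addr_ge0 // mulr_ge0 ?sqr_ge0.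
have {A00}Agt : 0 < A by rewrite lt_def A00.
rewrite -(ler_pM2l Agt) -subr_ge0.
have -> : A * (A * v ^+ 2 + B * u ^+ 2) - A * (2 * S * u * v) =
  (A * v - S * u) ^+ 2 + (A * B - S ^+ 2) * u ^+ 2 by ring.
by rewrite addr_ge0 ?sqr_ge0 // mulr_ge0 ?sqr_ge0 // subr_ge0.
Qed.

(** The point [c] is the first at which the partial sum, [c] included, exceeds half the total. The
    clause on the last index in [P] supplies a candidate when no partial sum does, as for zero
    weights. *)
Lemma median (w : nat -> R) (a b : nat) : (forall k, 0 <= w k) -> (a < b)%N ->
  exists c, [/\ (a <= c < b)%N,
    2 * \sum_(a <= k < c) w k <= \sum_(a <= k < b) w k &
    2 * \sum_(c.+1 <= k < b) w k <= \sum_(a <= k < b) w k].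
Proof.
move=> w0; case: b => // b; rewrite ltnS => ab; set W := \sum_(a <= k < b.+1) w k.
have W0 : 0 <= W by rewrite sumr_ge0.
pose P c := (a <= c)%N && ((b <= c)%N || (W < 2 * \sum_(a <= k < c.+1) w k)).
have Pb : P b by rewrite /P ab leqnn.
have [c /andP[ac Pc] cmin] := ex_minnP (ex_intro _ b Pb).
have cb : (c < b.+1)%N by rewrite ltnS cmin.
exists c; split; first by rewrite ac.
- have [->|ca] := eqVneq c a; first by rewrite big_geq // mulr0.
  have : ~~ P c.-1.
    apply/negP => /cmin; rewrite leqNgt => /negP; apply.
    by rewrite prednK // (leq_ltn_trans _ (_ : a < c)%N) // ltn_neqAle eq_sym ca.
  have c0 : (0 < c)%N by rewrite (leq_ltn_trans (leq0n a)) // ltn_neqAle eq_sym ca.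
  rewrite /P prednK // negb_and negb_or -leNgt -[(a <= _)%N]ltnS prednK //.
  by rewrite [(a < c)%N]ltn_neqAle eq_sym ca ac /= => /andP[].
- have [bc|cb'] := leqP b c; first by rewrite big_geq // mulr0.
  move: Pc; rewrite leqNgt cb' /= /W => Pc.
  have e := @big_cat_nat _ _ +%R _ _ _ xpredT w (leqW ac) cb.
  by rewrite e /= in Pc *; lra.
Qed.

(** For [p k = x k * f k] and [q l = y l * e l] this is the strict triangular truncation of the
    rank-one matrix [x k * y l], paired with [f] and [e]. *)
Definition tri (a b : nat) (p q : nat -> R[i]) : R[i] :=
  \sum_(a <= k < b) p k * \sum_(k.+1 <= l < b) q l.

(** The triangle k < l falls into two smaller triangles, the rectangle k < c <= l and the row k = c.
    The last two are products, so no truncation is left in them. *)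
Lemma tri_split (a c b : nat) (p q : nat -> R[i]) : (a <= c < b)%N ->
  tri a b p q = tri a c p q + tri c.+1 b p q
   + (\sum_(a <= k < c) p k) * (\sum_(c <= l < b) q l)
   + p c * \sum_(c.+1 <= l < b) q l.
Proof.
case/andP=> ac cb; rewrite /tri (@big_cat_nat _ _ _ c) //=; last exact: ltnW.
rewrite [X in _ + X = _]big_ltn //.
have -> : \sum_(a <= k < c) p k * (\sum_(k.+1 <= l < b) q l) =
  \sum_(a <= k < c) p k * (\sum_(k.+1 <= l < c) q l) +
  (\sum_(a <= k < c) p k) * (\sum_(c <= l < b) q l).
  rewrite big_distrl -big_split /=; apply: eq_big_nat => k /andP[_ kc].
  by rewrite -mulrDr -(@big_cat_nat _ _ _ c) //; exact: ltnW.
by ring.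
Qed.

Definition mass (a b : nat) (z : nat -> R[i]) : R :=
  \sum_(a <= k < b) modulus (z k) ^+ 2.

Lemma mass_ge0 a b z : 0 <= mass a b z.
Proof. by rewrite sumr_ge0 // => k _; rewrite sqr_ge0. Qed.

Lemma mass_split (a c b : nat) z : (a <= c < b)%N ->
  mass a b z = mass a c z + modulus (z c) ^+ 2 + mass c.+1 b z.
Proof.
case/andP=> ac cb; rewrite /mass (@big_cat_nat _ _ _ c) //=; last exact: ltnW.
by rewrite [X in _ + X = _]big_ltn // addrA.
Qed.

Lemma mass_ltn (c b : nat) z : (c < b)%N ->
  mass c b z = modulus (z c) ^+ 2 + mass c.+1 b z.
Proof. by move=> cb; rewrite /mass big_ltn. Qed.

(** The starting bound of the halving argument: the triangle is enlarged to the full square of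
    absolute values, Cauchy-Schwarz bounds each factor, and products of masses are bounded by
    sums. *)
Lemma tri_le (a b : nat) (x y e f : nat -> R[i]) :
  modulus (tri a b (fun k => x k * f k) (fun l => y l * e l)) <=
  (mass a b x + mass a b y) * (mass a b e + mass a b f).
Proof.
pose A := \sum_(a <= k < b) modulus (x k) * modulus (f k).
pose B := \sum_(a <= k < b) modulus (y k) * modulus (e k).
have A0 : 0 <= A by rewrite sumr_ge0 // => k _; rewrite mulr_ge0 ?modulus_ge0.
have B0 : 0 <= B by rewrite sumr_ge0 // => k _; rewrite mulr_ge0 ?modulus_ge0.
have AB : modulus (tri a b (fun k => x k * f k) (fun l => y l * e l)) <= A * B.
  rewrite (le_trans (modulus_sum _ _ _)) // /A big_distrl /= ler_sum_nat // => k.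
  case/andP=> ak kb; rewrite !modulusM ler_wpM2l ?mulr_ge0 ?modulus_ge0 //.
  rewrite (le_trans (modulus_sum _ _ _)) // /B [leRHS](@big_cat_nat _ _ _ k.+1) //=.
    rewrite -[leLHS]add0r; apply: lerD.
      by rewrite sumr_ge0 // => l _; rewrite mulr_ge0 ?modulus_ge0.
    by apply: ler_sum => l _; rewrite modulusM.
  exact: leqW.
apply: (le_trans AB).
have hA : A ^+ 2 <= mass a b x * mass a b f by exact: sum_cauchy_schwarz.
have hB : B ^+ 2 <= mass a b y * mass a b e by exact: sum_cauchy_schwarz.
have [mx my me mf] := And4 (mass_ge0 a b x) (mass_ge0 a b y) (mass_ge0 a b e) (mass_ge0 a b f).
set X := mass a b x in hA mx *; set Y := mass a b y in hB my *.
set E := mass a b e in hB me *; set F := mass a b f in hA mf *.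
rewrite -(@ler_pXn2r _ 2) // ?nnegrE ?mulr_ge0 ?addr_ge0 // !exprMn.
apply: (le_trans (ler_pM (sqr_ge0 _) (sqr_ge0 _) hA hB)).
have -> : X * F * (Y * E) = (X * Y) * (E * F) by ring.
by apply: ler_pM; rewrite ?mulr_ge0 //; nra.
Qed.

Lemma sum_modulusM_le n (p q : nat -> R[i]) (A B : R) :
  \sum_(i < n) modulus (p i) ^+ 2 <= A -> \sum_(i < n) modulus (q i) ^+ 2 <= B ->
  \sum_(i < n) modulus (p i * q i) <= (A + B) / 2.
Proof.
move=> hA hB.
apply: (@le_trans _ _ (\sum_(i < n) (modulus (p i) ^+ 2 + modulus (q i) ^+ 2) / 2)).
  apply: ler_sum => i _; rewrite modulusM.
  by have := sqr_ge0 (modulus (p i) - modulus (q i)); nra.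
by rewrite -big_distrl /= big_split /=; lra.
Qed.

(** Bessel's inequality for a matrix with [n] rows, demanded on every interval of columns because
    the halving argument passes to subintervals. *)
Definition bessel_family n (E : nat -> nat -> R[i]) : Prop :=
  forall (z : nat -> R[i]) (a b : nat),
    \sum_(i < n) modulus (\sum_(a <= k < b) z k * E i k) ^+ 2 <= mass a b z.

(* Halving the interval at a median of the mass splits off two rank-one blocks,
   whose trace norms are at most the mass; only the diagonal blocks are kept,
   and after [L] rounds their masses are at most [2^-L] times the initial one. *)
Lemma tri_bessel_le n (E F : nat -> nat -> R[i]) (x y : nat -> R[i]) :
  bessel_family n E -> bessel_family n F ->
  forall (L a b : nat),
  \sum_(i < n) modulus (tri a b (fun k => x k * F i k) (fun l => y l * E i l)) <=
  (mass a b x + mass a b y) *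
  (L%:R + (\sum_(i < n) (mass a b (E i) + mass a b (F i))) / 2 ^+ L).
Proof.
move=> bE bF; elim=> [|L IH] a b.
  rewrite add0r expr0 divr1 big_distrr /=; apply: ler_sum => i _.
  by rewrite tri_le.
have S0 a' b' : 0 <= \sum_(i < n) (mass a' b' (E i) + mass a' b' (F i)).
  by rewrite sumr_ge0 // => i _; rewrite addr_ge0 ?mass_ge0.
have [ba|ab] := leqP b a.
  rewrite big1 => [|i _]; last by rewrite /tri big_geq // modulus0.
  by rewrite mulr_ge0 ?addr_ge0 ?mass_ge0 ?ler0n // divr_ge0 ?exprn_ge0.
have [c [acb le_ac le_cb]] := @median (fun k => modulus (x k) ^+ 2 + modulus (y k) ^+ 2) a b
  (fun k => addr_ge0 (sqr_ge0 _) (sqr_ge0 _)) ab.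
rewrite !big_split /= -!/(mass _ _ _) in le_ac le_cb.
have /andP[ac cb] := acb.
have IH1 := IH a c; have IH2 := IH c.+1 b.
set T1 := fun i => tri a c (fun k => x k * F i k) (fun l => y l * E i l).
set T2 := fun i => tri c.+1 b (fun k => x k * F i k) (fun l => y l * E i l).
set p := fun i => \sum_(a <= k < c) x k * F i k.
set q := fun i => \sum_(c <= k < b) y k * E i k.
set p' := fun i => x c * F i c.
set q' := fun i => \sum_(c.+1 <= k < b) y k * E i k.
(* Together the two rank-one blocks cost at most the mass of [x] and [y], which pays for raising [L]
   by one. *)
have hpq : \sum_(i < n) modulus (p i * q i) <= (mass a c x + mass c b y) / 2.
  by apply: sum_modulusM_le; [exact: bF | exact: bE].
have hpq' : \sum_(i < n) modulus (p' i * q' i) <= (modulus (x c) ^+ 2 + mass c.+1 b y) / 2.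
  apply: sum_modulusM_le; last exact: bE.
  have := bF x c c.+1; rewrite /mass big_nat1 => h; apply: le_trans h.
  by apply: ler_sum => i _; rewrite big_nat1.
have split : \sum_(i < n) modulus (tri a b (fun k => x k * F i k) (fun l => y l * E i l)) <=
   \sum_(i < n) modulus (T1 i) + \sum_(i < n) modulus (T2 i) +
   \sum_(i < n) modulus (p i * q i) + \sum_(i < n) modulus (p' i * q' i).
  rewrite -!big_split /=; apply: ler_sum => i _; rewrite (tri_split _ _ acb).
  rewrite (le_trans (modulusD _ _)) // lerD2r (le_trans (modulusD _ _)) // lerD2r.
  exact: modulusD.
apply: (le_trans split).
have mE a' b' i : 0 <= mass a' b' (E i) := mass_ge0 _ _ _.
have SS : \sum_(i < n) (mass a c (E i) + mass a c (F i)) +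
          \sum_(i < n) (mass c.+1 b (E i) + mass c.+1 b (F i)) <=
          \sum_(i < n) (mass a b (E i) + mass a b (F i)).
  rewrite -big_split /=; apply: ler_sum => i _.
  rewrite !(mass_split _ acb).
  by have := sqr_ge0 (modulus (E i c)); have := sqr_ge0 (modulus (F i c)); lra.
move: IH1 IH2 SS (S0 a c) (S0 c.+1 b).
rewrite -/T1 -/T2.
set S1 := \sum_(i < n) (mass a c _ + _); set S2 := \sum_(i < n) (mass c.+1 b _ + _).
set S := \sum_(i < n) (mass a b _ + _) => IH1 IH2 SS S10 S20.
move: le_ac le_cb hpq hpq' IH1 IH2; rewrite (mass_ltn _ cb).
have := mass_split x acb; have := mass_split y acb.
have := mass_ge0 a c x; have := mass_ge0 a c y; have := mass_ge0 c.+1 b x; have := mass_ge0 c.+1 b y.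
have := sqr_ge0 (modulus (x c)); have := sqr_ge0 (modulus (y c)).
rewrite [2 ^+ L.+1]exprS invfM -[L.+1]addn1 natrD.
have : 0 <= (2 ^+ L)^-1 :> R by rewrite invr_ge0 exprn_ge0.
have : 0 <= L%:R :> R by [].
move: (mass a c x) (mass a c y) (mass c.+1 b x) (mass c.+1 b y) (mass a b x) (mass a b y).
move: (modulus (x c) ^+ 2) (modulus (y c) ^+ 2) (L%:R : R) (2 ^+ L)^-1.
move=> xc yc l d x1 y1 x2 y2 X Y l0 d0 yc0 xc0 y20 x20 y10 x10 eY eX.
move=> le1 le2 hpq hpq' IH1 IH2.
(* Each half carries at most half of the mass; this yields the additional factor 1/2 in front of the
   sums for [E] and [F]. *)
have k1 : (x1 + y1) * (l + S1 * d) <= (x1 + y1) * l + (X + Y) / 2 * (S1 * d).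
  by rewrite mulrDr lerD2l ler_wpM2r ?mulr_ge0 //; lra.
have k2 : (x2 + y2) * (l + S2 * d) <= (x2 + y2) * l + (X + Y) / 2 * (S2 * d).
  by rewrite mulrDr lerD2l ler_wpM2r ?mulr_ge0 //; lra.
have k3 : (X + Y) / 2 * ((S1 + S2) * d) <= (X + Y) / 2 * (S * d).
  by rewrite ler_wpM2l ?ler_wpM2r //; lra.
have k4 : (x1 + y1) * l + (x2 + y2) * l <= (X + Y) * l by rewrite -mulrDl ler_wpM2r //; lra.
have -> : (X + Y) * (l + 1 + S * (2^-1 * d)) = (X + Y) * l + (X + Y) + (X + Y) / 2 * (S * d) by ring.
by move: k3; rewrite [(S1 + S2) * d]mulrDl [_ * (_ + _)]mulrDr; lra.
Qed.

End TriangularTruncation.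

(** * Growth of sequences in a lattice with bounded square sampling *)

Lemma sq_le_exp2 (r : nat) : (4 <= r -> r ^ 2 <= 2 ^ r)%N.
Proof.
elim: r => // r IH; rewrite leq_eqVlt => /orP[/eqP <- //|]; rewrite ltnS => r4.
by have := IH r4; rewrite [(2 ^ _.+1)%N]expnS -!mulnn; nia.
Qed.

Lemma linear_le_exp2 (q r : nat) : (q * r.+1 <= q * (q + 5) + 2 ^ r)%N.
Proof.
have [h|h] := leqP r (q + 4); first by nia.
have := @sq_le_exp2 r; nia.
Qed.

(** The r-th sampling iterate has norm at most C^r but reaches indices of size 2^(2^r). The fourth
    power is the one needed in [growth], where the index is known only to exceed the preceding
    iterate; hence [r.+1]. *)
Lemma exp_le_double_exp (R : realType) (C : R) : 1 <= C ->
  exists2 D : R, 0 <= D & forall r : nat, C ^+ (4 * r.+1) <= D * 2 ^+ (2 ^ r).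
Proof.
move=> C1; have C0 : 0 <= C by apply: le_trans C1.
have [q hq] : exists q : nat, C ^+ 4 <= 2 ^+ q.
  exists (Num.truncn (C ^+ 4)).+1.
  have := truncnS_gt (C ^+ 4); move/ltW/le_trans; apply.
  by rewrite -natrX ler_nat ltnW // ltn_expl.
exists (2 ^+ (q * (q + 5))) => [|r]; first exact: exprn_ge0.
rewrite exprM -exprD (@le_trans _ _ (2 ^+ (q * r.+1))) //.
  by rewrite exprM ler_pXn2r ?nnegrE ?exprn_ge0.
by rewrite ler_weXn2l ?ler1n // linear_le_exp2.
Qed.

(** Monotonicity gives (j+1) s_j <= s_0 + ... + s_j, hence s_j^4 (j+1)^3 <= B and s_j^2 <= sqrt(B)
    (j+1)^(-3/2), which is compared with a telescoping sum. *)
Lemma sum_sq_tail_le (R : realType) (s : nat -> R) (B : R) : 0 <= B ->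
  (forall j, 0 <= s j) -> {homo s : j k / (j <= k)%N >-> k <= j} ->
  (forall k, (\sum_(j < k.+1) s j) ^+ 4 <= B * k.+1%:R) ->
  forall m M, (0 < m)%N ->
    \sum_(m <= j < M) s j ^+ 2 <= 2 * Num.sqrt B / Num.sqrt m%:R.
Proof.
move=> B0 s0 sd hS m M m0.
have s4 j : s j ^+ 4 * j.+1%:R ^+ 3 <= B.
  have h : s j * j.+1%:R <= \sum_(i < j.+1) s i.
    rewrite -[j.+1 in leLHS]card_ord mulrC mulr_natl -sumr_const ler_sum // => i _.
    by apply: sd; rewrite -ltnS.
  have h4 : (s j * j.+1%:R) ^+ 4 <= B * j.+1%:R.
    by apply: le_trans (hS j); rewrite ler_pXn2r ?nnegrE ?mulr_ge0 ?sumr_ge0.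
  rewrite -(@ler_pM2r _ (j.+1%:R)) ?ltr0n // (le_trans _ h4) // exprMn.
  by rewrite -mulrA -exprSr.
have s2 j : (0 < j)%N -> s j ^+ 2 <= 2 * Num.sqrt B * ((Num.sqrt j%:R)^-1 - (Num.sqrt j.+1%:R)^-1).
  move=> j0; pose v := Num.sqrt (j%:R : R); pose w := Num.sqrt (j.+1%:R : R).
  have v0 : 0 < v by rewrite sqrtr_gt0 ltr0n.
  have w0 : 0 < w by rewrite sqrtr_gt0 ltr0n.
  have v2 : v ^+ 2 = j%:R by rewrite sqr_sqrtr.
  have w2 : w ^+ 2 = j.+1%:R by rewrite sqr_sqrtr.
  have vw : v <= w by rewrite ler_sqrt ?ler_nat.
  have h1 : s j ^+ 2 * w ^+ 3 <= Num.sqrt B.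
    rewrite -(@ler_pXn2r _ 2) ?nnegrE ?mulr_ge0 ?exprn_ge0 ?sqrtr_ge0 ?(ltW w0) //.
    rewrite sqr_sqrtr // exprMn -!exprM [(3 * 2)%N]mulnC [w ^+ (2 * 3)]exprM w2.
    exact: s4.
  rewrite -/v -/w.
  (* The difference of reciprocals is 1 / (v w (v + w)), and v <= w. *)
  have h2 : w ^- 3 <= 2 * (v^-1 - w^-1).
    have -> : v^-1 - w^-1 = (w ^+ 2 - v ^+ 2) / (v * w * (w + v)).
      by field; rewrite !lt0r_neq0 // addr_gt0.
    rewrite w2 v2 -[j.+1]addn1 natrD addrAC subrr add0r mul1r -[leLHS]mul1r.
    rewrite ler_pdivrMr ?exprn_gt0 // mulrAC ler_pdivlMr ?mulr_gt0 ?addr_gt0 //.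
    by rewrite mul1r; have := sqr_ge0 w; nra.
  rewrite [2 * _]mulrC -mulrA.
  apply: (@le_trans _ _ (Num.sqrt B * w ^- 3)); last by rewrite ler_wpM2l ?sqrtr_ge0.
  by rewrite ler_pdivlMr ?exprn_gt0.
have [Mm|mM] := leqP M m; first by rewrite big_geq // divr_ge0 ?mulr_ge0 ?sqrtr_ge0.
apply: (@le_trans _ _ (\sum_(m <= j < M)
  2 * Num.sqrt B * ((Num.sqrt j%:R)^-1 - (Num.sqrt j.+1%:R)^-1))).
  by apply: ler_sum_nat => j /andP[mj _]; apply: s2; apply: leq_trans mj.
rewrite -big_distrr /= ler_wpM2l ?mulr_ge0 ?sqrtr_ge0 //.
rewrite (@telescope_sumr_eq _ _ _ (fun j => - (Num.sqrt (j%:R : R))^-1)) ?(ltnW mM) //.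
  by rewrite opprK addrC lerBlDr lerDl invr_ge0 sqrtr_ge0.
by move=> k _; rewrite opprK addrC.
Qed.
Section SequenceSpaces.
Context (R : realType) (F : banach_seq_lattice R).

Lemma seq_norm_fin (a : nat -> R) :
  (seq_norm F a < +oo)%E -> exists f, bsl_seq F f = a.
Proof.
apply: contraPP => /forallNP h; rewrite /seq_norm.
suff -> : [set f : bsl_space F | bsl_seq F f = a] = set0 by rewrite image_set0 ereal_inf0 ltxx.
by apply/seteqP; split=> // f /= /h.
Qed.

Lemma seq_normE (f : bsl_space F) : seq_norm F (bsl_seq F f) = (`|f|)%:E.
Proof.
rewrite /seq_norm.
suff -> : [set g : bsl_space F | bsl_seq F g = bsl_seq F f] = [set f].
  by rewrite image_set1 ereal_inf1.
by apply/seteqP; split=> [g /= /bsl_inj -> | g /= ->].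
Qed.

(** Since some element does not vanish at [k], solidity puts the unit sequence at [k] into [F]. Its
    multiple by the coordinate of [g] is dominated by [g]. *)
Lemma coordinate_bounded (f : bsl_space F) (k : nat) : bsl_seq F f k != 0 ->
  exists2 c, 0 <= c & forall g : bsl_space F, `|bsl_seq F g k| <= c * `|g|.
Proof.
move=> fk0; pose d (j : nat) : R := (j == k)%:R.
have [|d1 d1E _] := @bsl_solid R F ((bsl_seq F f k)^-1 *: f) d.
  move=> j; rewrite linearZ /d; case: eqVneq => [->|_]; last by rewrite normr0.
  by rewrite normr1 ; change (1 <= `|(bsl_seq F f k)^-1 * bsl_seq F f k|); rewrite mulVf // normr1.
have d1n : 0 < `|d1|.
  rewrite normr_gt0; apply/eqP => d10; have := congr1 (fun h => h k) d1E.
  by rewrite d10 linear0 /d eqxx => /eqP; rewrite eq_sym oner_eq0.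
exists `|d1|^-1 => [|g]; first by rewrite invr_ge0.
have [|h hE hg] := @bsl_solid R F g (bsl_seq F g k *: d).
  move=> j; change (`|bsl_seq F g k * d j| <= `|bsl_seq F g j|); rewrite /d.
  by case: eqVneq => [->|_]; rewrite ?mulr1 // mulr0 normr0.
have : bsl_seq F h = bsl_seq F (bsl_seq F g k *: d1) by rewrite hE linearZ d1E.
move/bsl_inj => hE'; rewrite hE' normrZ in hg.
by rewrite mulrC ler_pdivlMr.
Qed.

Hypothesis bounded : square_sampling_bounded F.

Lemma sampling_iter : exists2 C : R, 1 <= C & forall (r : nat) (f : bsl_space F),
  exists2 g, bsl_seq F g = (fun k => bsl_seq F f (k.+1 ^ (2 ^ r)).-1) & `|g| <= C ^+ r * `|f|.
Proof.
have [C hC] := bounded; pose D := Num.max C 1; exists D; first by rewrite /D le_max lexx orbT.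
elim=> [|r IH] f.
  exists f; last by rewrite mul1r.
  by apply/funext => k; rewrite expn0 expn1.
have [g gE gf] := IH f.
have [|h hE] := @seq_norm_fin (square_sampling (bsl_seq F g)).
  by apply: le_lt_trans (hC g) _; rewrite ltry.
exists h.
  rewrite hE; apply/funext => k; rewrite /square_sampling gE prednK ?expn_gt0 //.
  by rewrite -expnM -expnS.
have := hC g; rewrite -hE seq_normE lee_fin => /le_trans; apply.
rewrite exprS -mulrA (@le_trans _ _ (D * `|g|)) //.
  by rewrite ler_wpM2r // /D le_max lexx.
by rewrite ler_wpM2l // (@le_trans _ _ 1) // /D le_max lexx orbT.
Qed.

(** At one fixed coordinate the sampling iterates bound the sequence by a multiple of C^r at the
    indices (k0+1)^(2^r); monotonicity fills the gaps. *)
Lemma growth (f : bsl_space F) : {homo bsl_seq F f : j k / (j <= k)%N >-> j <= k} ->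
  (forall k, 0 <= bsl_seq F f k) ->
  exists2 B : R, 0 <= B & forall k, bsl_seq F f k ^+ 4 <= B * k.+1%:R.
Proof.
set S := bsl_seq F f => Sinc S0.
have [S1|/existsNP[k1 /eqP S1]] := pselect (forall k, S k = 0).
  by exists 0 => // k; rewrite S1 expr0n mul0r.
(* The next position still carries a nonzero value and makes the base [k0.+1] at least two, so that
   its iterated squares exceed every index. *)
pose k0 := k1.+1.
have Sk0 : S k0 != 0 by rewrite gt_eqF // (lt_le_trans _ (Sinc k1 _ _)) // lt_def S1 S0.
have [c c0 hc] := coordinate_bounded Sk0.
have [C C1 hC] := sampling_iter.
have C0 : 0 <= C by apply: le_trans C1.
have hS r : S (k0.+1 ^ (2 ^ r)).-1 <= c * (C ^+ r * `|f|).
  have [g gE gf] := hC r f.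
  apply: le_trans (_ : `|bsl_seq F g k0| <= _); first by rewrite gE ler_norm.
  by apply: le_trans (hc g) _; rewrite ler_wpM2l.
have [D D0 hD] := exp_le_double_exp C1.
exists ((c * `|f|) ^+ 4 * (D + 1)) => [|k].
  by rewrite mulr_ge0 ?exprn_ge0 ?mulr_ge0 ?addr_ge0.
(* For the least such [r] the preceding iterate is at most [k.+1], so 2^(2^(r-1)) <= k+1. The
   summand 1 in [D + 1] covers [r = 0]. *)
have [r hr rmin] : exists2 r, (k.+1 < k0.+1 ^ (2 ^ r))%N &
    forall r', (k.+1 < k0.+1 ^ (2 ^ r'))%N -> (r <= r')%N.
  have ex : exists r, (k.+1 < k0.+1 ^ (2 ^ r))%N.
    exists k.+1; apply: (@leq_trans (2 ^ k.+1)%N); first exact: ltn_expl.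
    apply: (@leq_trans (2 ^ (2 ^ k.+1))%N).
      by apply: leq_pexp2l => //; apply: ltnW; apply: ltn_expl.
    by rewrite leq_exp2r // expn_gt0.
  by have [r h1 h2] := ex_minnP ex; exists r.
have Sk : S k <= c * (C ^+ r * `|f|).
  by apply: le_trans (hS r); apply: Sinc; rewrite -ltnS prednK ?expn_gt0 // ltnW.
have Sk4 : S k ^+ 4 <= (c * `|f|) ^+ 4 * C ^+ (4 * r).
  rewrite mulnC exprM -exprMn -mulrA [`|f| * _]mulrC.
  by rewrite ler_pXn2r ?nnegrE ?mulr_ge0 ?exprn_ge0.
apply: (le_trans Sk4); rewrite -[leRHS]mulrA ler_wpM2l ?exprn_ge0 ?mulr_ge0 //.
case: r hr rmin {Sk Sk4} => [|r] hr rmin.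
  rewrite muln0 expr0 mulrDl mul1r -[leLHS]add0r lerD ?mulr_ge0 // ?ler1n //.
have hr' : (k0.+1 ^ (2 ^ r) <= k.+1)%N by rewrite leqNgt; apply/negP => /rmin; rewrite ltnn.
apply: le_trans (hD r) _; rewrite mulrDl ler_wpDr ?ler0n // ler_wpM2l // -natrX ler_nat.
by apply: leq_trans hr'; rewrite leq_exp2r // expn_gt0.
Qed.

(* The fourth power makes [n] times the Hilbert-Schmidt norm of the tail
   bounded. *)
Lemma tail_bound (s : nat -> R) (f : bsl_space F) :
  (forall j, 0 <= s j) -> {homo s : j k / (j <= k)%N >-> k <= j} ->
  bsl_seq F f = (fun k => \sum_(j < k.+1) s j) ->
  exists2 B, 0 <= B & forall n M, (0 < n)%N ->
    n%:R ^+ 2 * \sum_((n ^ 4)%N <= j < M) s j ^+ 2 <= (B * s 0%N) ^+ 2.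
Proof.
move=> s0 sd fE.
have [s00|s00] := eqVneq (s 0%N) 0.
  exists 0 => // n M _; rewrite big1 ?mulr0 ?mul0r ?expr0n // => j _.
  by have -> : s j = 0; [apply/eqP; rewrite eq_le s0 -s00 sd | rewrite expr0n].
have [||B B0 hB] := @growth f; rewrite ?fE.
- move=> j k jk; rewrite -!(big_mkord xpredT s) (@big_cat_nat _ _ _ j.+1 0 k.+1) //=.
  by rewrite lerDl sumr_ge0.
- by move=> k; rewrite sumr_ge0.
rewrite fE in hB.
(* The bound is written as a multiple of [s 0], because [s 0] is dominated by every partial sum. *)
exists (Num.sqrt (2 * Num.sqrt B) / s 0%N) => [|n M n0]; first by rewrite divr_ge0 ?sqrtr_ge0.
rewrite divfK // sqr_sqrtr ?mulr_ge0 ?sqrtr_ge0 //.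
have := @sum_sq_tail_le R s B B0 s0 sd hB (n ^ 4) M.
rewrite expn_gt0 n0 => /(_ isT).
have -> : Num.sqrt ((n ^ 4)%:R : R) = n%:R ^+ 2.
  by rewrite natrX (exprM _ 2 2) sqrtr_sqr ger0_norm ?exprn_ge0.
by rewrite ler_pdivlMr ?exprn_gt0 ?ltr0n // mulrC.
Qed.

(** Sampling at squares twice gives the values of [S] at fourth powers, so the dominating sequence
    lies in [F] and solidity applies. *)
Lemma log_domination (S u : nat -> R) (f : bsl_space F) (B : R) :
  bsl_seq F f = S -> 0 <= B -> (forall k, 0 <= u k) ->
  (forall k, u k <= B * ln (expR 1 * k.+1%:R) * S ((k.+1 ^ 4).-1)%N) ->
  (seq_norm F (fun k => (ln (expR 1 * k.+1%:R))^-1 * u k)%R < +oo)%E.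
Proof.
move=> fS B0 u0 hu; have [C C1 hC] := sampling_iter.
have [g gE _] := hC 2%N f.
have [|h hE _] := @bsl_solid R F (B *: g) (fun k => (ln (expR 1 * k.+1%:R))^-1 * u k).
  move=> k; have l0 : 0 < ln (expR 1 * k.+1%:R) :> R.
    by rewrite lnM ?posrE ?expR_gt0 ?ltr0n // expRK ltr_wpDr // ln_ge0 // ler1n.
  rewrite ger0_norm ?mulr_ge0 ?invr_ge0 ?(ltW l0) // linearZ gE fS.
  change ((ln (expR 1 * k.+1%:R))^-1 * u k <= `|B * S (k.+1 ^ 2 ^ 2).-1|).
  apply: le_trans (ler_norm _); rewrite mulrC ler_pdivrMr // mulrAC.
  exact: hu.
by rewrite -hE seq_normE ltry.
Qed.

End SequenceSpaces.

(** * Compact operators *)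

Section BoundedOperators.
Context (R : realType) (H : completeNormedModType R[i]).
Implicit Types (T S : H -> H) (x y z : H).

Lemma op0 T : linear T -> T 0 = 0.
Proof.
move=> lT; have := lT 1 0 0; rewrite scale1r addr0 scale1r => /eqP.
by rewrite -subr_eq0 opprD addNKr oppr_eq0 => /eqP.
Qed.

Lemma opD T : linear T -> {morph T : x y / x + y}.
Proof. by move=> lT x y; have := lT 1 x y; rewrite !scale1r. Qed.

Lemma opZ T : linear T -> forall a x, T (a *: x) = a *: T x.
Proof. by move=> lT a x; have := lT a x 0; rewrite !addr0 op0 // addr0. Qed.

Lemma opB T : linear T -> {morph T : x y / x - y}.
Proof. by move=> lT x y; rewrite opD // -scaleN1r opZ // scaleN1r. Qed.

Lemma op_sum T : linear T -> forall (I : Type) (s : seq I) (P : pred I) (f : I -> H),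
  T (\sum_(i <- s | P i) f i) = \sum_(i <- s | P i) T (f i).
Proof.
by move=> lT I s P f; apply: (big_morph T (opD lT) (op0 lT)).
Qed.

Lemma bounded_op_bound T : bounded_op T ->
  exists2 K, 0 <= K & forall x, rnorm (T x) <= K * rnorm x.
Proof.
case=> lT cT; pose L := HB.pack_for {linear H -> H} T (GRing.isLinear.Build _ _ _ _ T lT).
have /linear_bounded_continuous/linear_boundedP/pinfty_ex_gt0[K K0 hK] :
  continuous L by exact: cT.
have KR : K = (complex.Re K)%:C by rewrite RRe_real // realE (ltW K0).
exists (complex.Re K) => [|x]; first by rewrite -lecR -KR ltW.
by have := hK x; rewrite !rnormE KR -rmorphM lecR.
Qed.

Lemma bounded_opI T (K : R) : linear T ->
  (forall x, rnorm (T x) <= K * rnorm x) -> bounded_op T.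
Proof.
move=> lT hK; split=> //.
pose L := HB.pack_for {linear H -> H} T (GRing.isLinear.Build _ _ _ _ T lT).
suff : continuous L by [].
apply/linear_bounded_continuous/linear_boundedP.
exists K%:C; split; first by rewrite complex_real.
(* Comparability in [R[i]] forces equal imaginary parts, so [r] is real. *)
move=> r Kr x; have r0 : r = (complex.Re r)%:C.
  by rewrite RRe_real //; move: Kr; rewrite ltcE /= => /andP[/eqP i0 _]; case: r i0 => a b /= ->; rewrite complex_real.
rewrite r0 ltcR in Kr; rewrite r0 !rnormE -rmorphM lecR.
by rewrite (le_trans (hK x)) // ler_wpM2r ?rnorm_ge0 // ltW.
Qed.

Lemma nbhs_rnorm y (A : set H) : nbhs y A <->
  exists2 e : R, 0 < e & forall z, rnorm (y - z) < e -> A z.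
Proof.
split=> [/nbhs_normP[e /= e0 hA]|[e e0 hA]].
  have eR : e = (complex.Re e)%:C by rewrite RRe_real // realE (ltW e0).
  exists (complex.Re e) => [|z hz]; first by rewrite -ltcR -eR.
  by apply: hA; rewrite /= eR rnormE ltcR.
apply/nbhs_normP; exists e%:C; first by rewrite /= ltcR.
by move=> z; rewrite /= rnormE ltcR; apply: hA.
Qed.

Lemma complete_seq (x : nat -> H) :
  (forall e, 0 < e -> exists N, forall k l, (N <= k)%N -> (N <= l)%N -> rnorm (x k - x l) < e) ->
  exists y, forall e, 0 < e -> exists N, forall k, (N <= k)%N -> rnorm (x k - y) < e.
Proof.
move=> hx; have cx : cauchy (x @ \oo).
  apply: cauchy_exP => e e0.
  have eR : e = (complex.Re e)%:C by rewrite RRe_real // realE (ltW e0).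
  have [|N hN] := hx (complex.Re e); first by rewrite -ltcR -eR.
  exists (x N); exists N => // k /= Nk; rewrite -ball_normE /= eR rnormE ltcR.
  exact: hN.
have /cvg_ex[y hy] : cvg (x @ \oo) by exact: cauchy_cvg.
exists y => e e0.
have [N _ hN] : (x @ \oo) [set z | rnorm (y - z) < e].
  by apply: hy; apply/nbhs_rnorm; exists e.
by exists N => k Nk; rewrite rnormBC; apply: hN.
Qed.

(** A cluster point of the filter generated by the T x_k replaces the limit of a subsequence. *)
Lemma compact_op_cluster T : compact_op T -> forall x : nat -> H,
  (forall k, rnorm (x k) <= 1) ->
  exists y, forall (e : R) (N : nat), 0 < e -> exists2 k, (N <= k)%N & rnorm (T (x k) - y) < e.
Proof.
case=> _; rewrite precompactE => cT x hx.
pose G : set_system H := (T \o x) @ \oo.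
have GA : G (closure [set T x | x in [set x | `|x| <= 1]]).
  exists 0%N => // k _; apply: subset_closure; exists (x k) => //=.
  by rewrite rnormE -[1]/(1%:C) lecR.
have [y [_ hy]] := cT G _ GA.
exists y => e N e0.
have [||_ [[k Nk <-] /= h]] := hy [set z | exists2 k, (N <= k)%N & T (x k) = z] [set z | rnorm (y - z) < e].
- by exists N => // k Nk; exists k.
- by apply/nbhs_rnorm; exists e.
- by exists k => //; rewrite rnormBC.
Qed.

Lemma compact_op_comp T P : compact_op T -> linear P ->
  (forall x, rnorm (P x) <= rnorm x) -> compact_op (T \o P).
Proof.
move=> [[lT cT] pT] lP hP; split.
  have [K K0 hK] := bounded_op_bound (conj lT cT).
  apply: (@bounded_opI _ K) => [a u v /=|x /=]; first by rewrite lP lT.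
  by rewrite (le_trans (hK _)) // ler_wpM2l.
apply: precompact_subset pT => _ [x /= hx <-]; exists (P x) => //=.
move: hx; rewrite !rnormE -[1]/(1%:C) !lecR => hx.
exact: le_trans (hP x) hx.
Qed.

Lemma compact_op_sub T S (a : R[i]) : compact_op T -> compact_op S ->
  compact_op (fun x => T x - a *: S x).
Proof.
move=> [bT pT] [bS pS]; have [[lT _] [lS _]] := (bT, bS).
have [K K0 hK] := bounded_op_bound bT; have [M M0 hM] := bounded_op_bound bS.
split.
  apply: (@bounded_opI _ (K + modulus a * M)) => [c u v|x].
    rewrite lT lS scalerDr !scalerA [a * c]mulrC -scalerA scalerBr opprD.
    by rewrite !addrA; congr (_ + _); rewrite addrAC.
  rewrite (le_trans (rnormD _ _)) // rnormN rnormZ mulrDl lerD // -mulrA.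
  by rewrite ler_wpM2l ?modulus_ge0.
rewrite precompactE in pT; rewrite precompactE in pS.
pose g (p : H * H) := p.1 - a *: p.2.
have cg : continuous g.
  move=> p; apply: cvgB; first exact: cvg_fst.
by apply: cvgZl_tmp; exact: cvg_snd.
have := continuous_compact (continuous_subspaceT cg) (compact_setX pT pS).
move/(compact_precompact (@norm_hausdorff _ _)); apply: precompact_subset.
move=> _ [x hx <-]; exists (T x, S x) => //; split; apply: subset_closure; exists x => //.
Qed.

End BoundedOperators.

(** * Riesz representation and adjoints *)

Section Selfadjoint.
Context (R : realType) (H : completeNormedModType R[i]).
Context (ip : {dot H for (@Num.conj R[i])}).
Hypothesis hip : hilbert ip.
Implicit Types (T J : H -> H) (x y z : H).

(** First variation: if c = <x, y> were nonzero, the coefficient -tc would lower the norm. The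
    summand 1 in [t] keeps its denominator positive. *)
Lemma ip_eq0_of_min x y : (forall a, rnorm x <= rnorm (x + a *: y)) -> ip x y = 0.
Proof.
move=> hmin; apply/eqP; rewrite -modulus_eq0; apply: contraT => c0.
set c := ip x y in c0 *.
have mc : 0 < modulus c by rewrite lt_def c0 modulus_ge0.
pose t := (rnorm y ^+ 2 + 1)^-1.
have t0 : 0 < t by rewrite invr_gt0 ltr_wpDl ?sqr_ge0.
have := hmin (- (t%:C * c)).
rewrite -(@ler_pXn2r _ 2) ?nnegrE ?rnorm_ge0 // (rnormD2 hip) rnormZ ipZr -/c.
rewrite rmorphN rmorphM /= conj_real mulNr -mulrA [Num.conj c * _]mulrC modulusK.
rewrite -rmorphM raddfN /= modulusN modulusM modulus_real gtr0_norm //.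
have e : t * (rnorm y ^+ 2 + 1) = 1 by rewrite mulVf // lt0r_neq0 // ltr_wpDl ?sqr_ge0.
have -> : (t * modulus c * rnorm y) ^+ 2 = (t * modulus c ^+ 2) * (t * (rnorm y ^+ 2 + 1)) - t ^+ 2 * modulus c ^+ 2 by ring.
rewrite e mulr1; set d := t * modulus c ^+ 2.
have d0 : 0 < d by rewrite mulr_gt0 ?exprn_gt0.
have := sqr_ge0 (t * modulus c); rewrite exprMn; lra.
Qed.

(** The representing vector is a multiple of the vector of least norm in the hyperplane phi = 1. The
    parallelogram law makes a minimizing sequence Cauchy, and minimality makes its limit orthogonal
    to the kernel. *)
Lemma riesz (phi : H -> R[i]) (K : R) :
  (forall a x y, phi (a *: x + y) = a * phi x + phi y) ->
  (forall x, modulus (phi x) <= K * rnorm x) ->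
  exists z, forall x, phi x = ip x z.
Proof.
move=> lphi hK.
have phi0 : phi 0 = 0.
  by apply/eqP; rewrite -modulus_eq0 eq_le modulus_ge0 andbT (le_trans (hK _)) // rnorm0 mulr0.
have phiZ a x : phi (a *: x) = a * phi x by rewrite -[a *: x]addr0 lphi phi0 addr0.
have phiD x y : phi (x + y) = phi x + phi y by rewrite -[x]scale1r lphi mul1r scale1r.
have phiB x y : phi (x - y) = phi x - phi y by rewrite phiD -scaleN1r phiZ mulN1r.
have [h0|/existsNP[w /eqP w0]] := pselect (forall x, phi x = 0).
  by exists 0 => x; rewrite h0 ip0r.
pose A := [set rnorm x | x in [set x | phi x = 1]].
have infA : has_inf A.
  split; last by exists 0 => _ [x _ <-]; exact: rnorm_ge0.
  by exists (rnorm ((phi w)^-1 *: w)), ((phi w)^-1 *: w) => //=; rewrite phiZ mulVf.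
pose d := inf A.
have dle x : phi x = 1 -> d <= rnorm x.
  by move=> px; apply: ge_inf; [exact: infA.2 | exists x].
have d0 : 0 <= d by apply: lb_le_inf; [exact: infA.1 | move=> _ [x _ <-]; exact: rnorm_ge0].
have ex k : exists x, phi x = 1 /\ rnorm x < d + k.+1%:R^-1.
  have [|_ [x px <-] hx] := @inf_adherent _ A (k.+1%:R^-1) _ infA; first by rewrite invr_gt0 ltr0n.
  by exists x.
have [x hx] := choice ex.
have [|y hy] := @complete_seq R H x.
  move=> e e0.
  (* Two vectors of the hyperplane with norms at most d + g have squared distance at most 4(d + g)^2
     - 4d^2, as their midpoint has norm at least d. For g <= 1 this is at most (8d + 4)g, which the
     choice of [g] keeps below e^2. *)
  pose g := e ^+ 2 / (8 * d + 4 + e ^+ 2).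
  have den : 0 < 8 * d + 4 + e ^+ 2 by have := sqr_ge0 e; lra.
  have g0 : 0 < g by rewrite divr_gt0 ?exprn_gt0.
  have g1 : g <= 1 by rewrite ler_pdivrMr // mul1r; lra.
  have ge : (8 * d + 4) * g < e ^+ 2.
    rewrite mulrA ltr_pdivrMr // mulrC ltr_pM2l ?exprn_gt0 //.
    by have := exprn_gt0 2 e0; lra.
  have [N hN] : exists N : nat, N.+1%:R^-1 < g.
    exists (Num.truncn g^-1); rewrite invf_plt ?posrE ?ltr0n //.
    exact: truncnS_gt.
  have hN' k : (N <= k)%N -> rnorm (x k) <= d + g.
    move=> Nk; apply/ltW/(lt_trans (hx k).2); rewrite ltrD2l (le_lt_trans _ hN) //.
    by rewrite lef_pV2 ?posrE ?ltr0n // ler_nat ltnS.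
  exists N => k l Nk Nl.
  have h1 := hN' k Nk; have h2 := hN' l Nl.
  have h3 : 2 * d <= rnorm (x k + x l).
    have p1 : phi (2^-1 *: (x k + x l)) = 1.
      by rewrite phiZ phiD (hx k).1 (hx l).1 -[1 + 1]/2%:R mulVf // pnatr_eq0.
    have := dle _ p1; rewrite rnormZ modulusV -(rmorph_nat (real_complex R)).
    by rewrite modulus_real normr_nat mulrC ler_pdivlMr // mulrC.
  have := parallelogram hip (x k) (x l).
  rewrite -(@ltr_pXn2r _ 2) ?nnegrE ?rnorm_ge0 ?(ltW e0) // => hp.
  have s1 : rnorm (x k) ^+ 2 <= (d + g) ^+ 2 by rewrite ler_pXn2r ?nnegrE ?rnorm_ge0 // addr_ge0 // ltW.
  have s2 : rnorm (x l) ^+ 2 <= (d + g) ^+ 2 by rewrite ler_pXn2r ?nnegrE ?rnorm_ge0 // addr_ge0 // ltW.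
  have s3 : (2 * d) ^+ 2 <= rnorm (x k + x l) ^+ 2 by rewrite ler_pXn2r ?nnegrE ?rnorm_ge0 // mulr_ge0.
  have s4 : g ^+ 2 <= g by rewrite expr2 ler_piMl // ltW.
  have s5 : (d + g) ^+ 2 = d ^+ 2 + 2 * d * g + g ^+ 2 by ring.
  have s6 : (2 * d) ^+ 2 = 4 * d ^+ 2 by ring.
  have s7 : (8 * d + 4) * g = 4 * (2 * d * g) + 4 * g by ring.
  lra.
have py : phi y = 1.
  apply/eqP; rewrite -subr_eq0 -modulus_eq0 eq_le modulus_ge0 andbT.
  apply/ler_addgt0Pr => e e0; rewrite add0r.
  have K0 : 0 < `|K| + 1 by rewrite ltr_wpDl.
  have [|N hN] := hy (e / (`|K| + 1)); first by rewrite divr_gt0.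
  have := hN N (leqnn N); rewrite ltr_pdivlMr // => hN1.
  rewrite -(hx N).1 -phiB -modulusN -(mulN1r (phi _)) -phiZ scaleN1r opprB.
  apply: le_trans (hK _) _; apply: le_trans (ltW hN1); rewrite mulrC.
  by rewrite ler_wpM2l ?rnorm_ge0 // (le_trans (ler_norm K)) // lerDl.
have yd : rnorm y <= d.
  apply/ler_addgt0Pr => e e0.
  have [|N hN] := hy (e / 2); first by rewrite divr_gt0.
  have [M hM] : exists M : nat, M.+1%:R^-1 < e / 2.
    exists (Num.truncn (e / 2)^-1); rewrite invf_plt ?posrE ?ltr0n ?divr_gt0 //.
    exact: truncnS_gt.
  have h1 := hN (maxn N M) (leq_maxl N M).
  have h2 := (hx (maxn N M)).2.
  have h3 : (maxn N M).+1%:R^-1 <= M.+1%:R^-1 :> R.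
    by rewrite lef_pV2 ?posrE ?ltr0n // ler_nat ltnS leq_maxr.
  have h4 := rnorm_sub_le y (x (maxn N M)) 0; rewrite !subr0 rnormBC in h4.
  have h5 : rnorm (x (maxn N M)) < d + e / 2.
    by apply: (lt_trans h2); rewrite ltrD2l (le_lt_trans h3).
  by move: h1 h4 h5; lra.
have yker z : phi z = 0 -> ip y z = 0.
  move=> pz; apply: ip_eq0_of_min => a; apply: (le_trans yd); apply: dle.
  by rewrite phiD phiZ pz mulr0 addr0.
have y0 : rnorm y != 0.
  by rewrite rnorm_eq0; apply/eqP => y0; move: py; rewrite y0 phi0 => /eqP; rewrite eq_sym oner_eq0.
exists (((rnorm y ^+ 2)^-1)%:C *: y) => v.
have : ip y (v - phi v *: y) = 0 by apply: yker; rewrite phiB phiZ py mulr1 subrr.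
move/(congr1 Num.conj); rewrite (ipC ip) rmorph0 ipBl ipZl (ipxx hip) => /eqP.
rewrite subr_eq0 => /eqP hv; rewrite ipZr conj_real hv mulrCA -rmorphM /= mulVf ?mulr1 //.
by rewrite sqrf_eq0.
Qed.

Lemma adjointP T : bounded_op T -> forall x y, ip (T x) y = ip x (adjoint ip T y).
Proof.
move=> bT x y; have [lT _] := bT; have [K K0 hK] := bounded_op_bound bT.
(* Once the set is nonempty, [xget] selects a member of it and not its default. *)
suff ex : exists z, [set z | forall x, ip (T x) y = ip x z] z.
  by have [z hz] := ex; have /= := xgetPex 0 ex; apply.
apply: (@riesz (fun x => ip (T x) y) (K * rnorm y)) => [a u v|u].
  by rewrite lT ipDl ipZl.
by rewrite (le_trans (cauchy_schwarz hip _ _)) // mulrAC ler_wpM2r // rnorm_ge0.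
Qed.

Definition selfadjoint J : Prop := forall x y, ip (J x) y = ip x (J y).

Lemma selfadjoint_adjoint J : selfadjoint J -> adjoint ip J = J.
Proof.
move=> sJ; apply/funext => y; apply: (ip_inj hip) => x.
have /= := xgetPex 0 (ex_intro [set z | forall x, ip (J x) y = ip x z] (J y) (fun x => sJ x y)).
by move=> <-.
Qed.

Lemma imag_part_selfadjoint T : bounded_op T -> selfadjoint (imag_part ip T).
Proof.
move=> bT x y; have aT := adjointP bT.
have aT' u v : ip (adjoint ip T u) v = ip u (T v) by rewrite -(ipC ip) -aT (ipC ip).
rewrite /imag_part ipZl ipZr ipBl ipBr aT aT' rmorphV ?unitfE ?mulf_neq0 ?neq0Ci ?pnatr_eq0 //.
by rewrite rmorphM /= conjCi rmorph_nat mulrN invrN mulNr -mulrN opprB.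
Qed.

Lemma real_partE T x : real_part ip T x = T x - 'i%R *: imag_part ip T x.
Proof.
rewrite /real_part /imag_part scalerA.
have -> : 'i%R * (2 * 'i%R)^-1 = 2^-1 :> R[i] by rewrite invfM mulrCA mulfV ?mulr1 ?neq0Ci.
rewrite scalerBr opprB scalerDr addrCA addrC; congr (_ + _).
rewrite -{2}[T x]scale1r -scalerBl; congr (_ *: _).
by field.
Qed.

Lemma real_part_selfadjoint T : bounded_op T -> selfadjoint (real_part ip T).
Proof.
move=> bT x y; have aT := adjointP bT.
have aT' u v : ip (adjoint ip T u) v = ip u (T v) by rewrite -(ipC ip) -aT (ipC ip).
rewrite /real_part ipZl ipZr ipDl ipDr aT aT' rmorphV ?unitfE ?pnatr_eq0 //.
by rewrite rmorph_nat addrC.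
Qed.

End Selfadjoint.

(** * Spectral theorem for compact selfadjoint operators *)

Section SpectralTheorem.
Context (R : realType) (H : completeNormedModType R[i]).
Context (ip : {dot H for (@Num.conj R[i])}).
Hypothesis hip : hilbert ip.
Implicit Types (T J : H -> H) (x y z : H).

(** A vector at which [J] nearly attains its norm [m] is an approximate eigenvector of J^2 for m^2:
    the square is expanded with <JJx, x> = |Jx|^2. *)
Lemma rnorm_selfadjoint_sub J x (m : R) : selfadjoint ip J ->
  (forall x, rnorm (J x) <= m * rnorm x) -> 0 <= m -> rnorm x <= 1 ->
  rnorm (J (J x) - (m ^+ 2)%:C *: x) ^+ 2 <= m ^+ 2 * (m ^+ 2 - rnorm (J x) ^+ 2).
Proof.
move=> sJ hm m0 hx; rewrite (rnormB2 hip) rnormZ ipZr conj_real sJ.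
have -> : ip (J x) (J x) = (rnorm (J x) ^+ 2)%:C by rewrite ipxx.
rewrite -rmorphM /= modulus_real ger0_norm ?sqr_ge0 //.
have h1 : rnorm (J (J x)) ^+ 2 <= m ^+ 2 * rnorm (J x) ^+ 2.
  by rewrite -exprMn ler_pXn2r ?nnegrE ?rnorm_ge0 ?mulr_ge0 ?rnorm_ge0.
have h2 : (m ^+ 2 * rnorm x) ^+ 2 <= m ^+ 2 * m ^+ 2.
  by rewrite -expr2 ler_pXn2r ?nnegrE ?mulr_ge0 ?sqr_ge0 ?rnorm_ge0 // ler_piMr // sqr_ge0.
by lra.
Qed.

(** A maximizing sequence for the norm m of [J] yields y with J^2 y = m^2 y, and (J - m)(J + m) y =
    0 gives an eigenvector for m or -m. The zero operator gets the pair [(0, 0)]. *)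
Lemma selfadjoint_max_eigenvector J : compact_op J -> selfadjoint ip J ->
  exists p : H * R, [/\ J p.1 = p.2%:C *: p.1,
    forall x, rnorm (J x) <= `|p.2| * rnorm x,
    p.2 != 0 -> rnorm p.1 = 1 & p.2 = 0 -> p.1 = 0].
Proof.
move=> cJ sJ; have [bJ _] := cJ; have [lJ _] := bJ.
have [K K0 hK] := bounded_op_bound bJ.
pose A := [set rnorm (J x) | x in [set x | rnorm x <= 1]].
have supA : has_sup A.
  split; first by exists (rnorm (J 0)), 0; rewrite //= rnorm0.
  exists K => _ [x hx <-]; apply: le_trans (hK x) _.
  by rewrite ler_piMr.
pose m := sup A.
have m0 : 0 <= m.
  apply: le_trans (rnorm_ge0 (J 0)) _; apply: ub_le_sup; first exact: supA.2.
  by exists 0; rewrite //= rnorm0.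
have hm x : rnorm (J x) <= m * rnorm x.
  have [->|x0] := eqVneq x 0; first by rewrite op0 // rnorm0 mulr0.
  have nx : 0 < rnorm x by rewrite lt_def rnorm_ge0 rnorm_eq0 x0.
  have : rnorm (J ((rnorm x)^-1%:C *: x)) <= m.
    apply: ub_le_sup; first exact: supA.2.
    exists ((rnorm x)^-1%:C *: x) => //=.
    by rewrite rnormZ modulus_real ger0_norm ?invr_ge0 ?rnorm_ge0 // mulVf // lt0r_neq0.
  rewrite opZ // rnormZ modulus_real ger0_norm ?invr_ge0 ?rnorm_ge0 //.
  by rewrite mulrC ler_pdivrMr.
have [m00|mn0] := eqVneq m 0.
  exists (0, 0); split => //=; [by rewrite op0 // scaler0| |by rewrite eqxx].
  by move=> x; rewrite normr0 -m00.
have mgt : 0 < m by rewrite lt_def mn0.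
suff [y y0 Jy] : exists2 y, y != 0 & J (J y) = (m ^+ 2)%:C *: y.
  have gen (z : H) (l : R) : z != 0 -> `|l| = m -> J z = l%:C *: z ->
    exists p : H * R, [/\ J p.1 = p.2%:C *: p.1,
    forall x, rnorm (J x) <= `|p.2| * rnorm x,
    p.2 != 0 -> rnorm p.1 = 1 & p.2 = 0 -> p.1 = 0].
    move=> z0 lm Jz; exists ((rnorm z)^-1%:C *: z, l); split => /=.
    - by rewrite opZ // Jz !scalerA mulrC.
    - by move=> x; rewrite lm.
    - rewrite rnormZ modulus_real ger0_norm ?invr_ge0 ?rnorm_ge0 // mulVf //.
      by rewrite rnorm_eq0.
    - by move=> l0; move: lm; rewrite l0 normr0 => e; rewrite -e eqxx in mn0.
  have [z0|z0] := eqVneq (J y + m%:C *: y) 0.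
    apply: (gen y (- m)) => //; first by rewrite normrN ger0_norm.
    by rewrite rmorphN scaleNr; apply/eqP; rewrite -addr_eq0 z0.
  apply: (gen _ m z0); first by rewrite ger0_norm.
  by rewrite opD // opZ // Jy scalerDr scalerA -rmorphM -expr2 addrC.
have ex k : exists x, rnorm x <= 1 /\ m ^+ 2 - k.+1%:R^-1 < rnorm (J x) ^+ 2.
  have [e e0 he] : exists2 e, 0 < e & forall t, m - e < t -> 0 <= t -> m ^+ 2 - k.+1%:R^-1 < t ^+ 2.
    have k0 : 0 < k.+1%:R^-1 :> R by rewrite invr_gt0 ltr0n.
    exists (k.+1%:R^-1 / (2 * m)) => [|t]; first by rewrite divr_gt0 ?mulr_gt0.
    move: (k.+1%:R^-1) k0 => g g0 ht t0.
    have : 2 * m * (m - g / (2 * m)) < 2 * m * t by rewrite ltr_pM2l ?mulr_gt0.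
    rewrite mulrBr [X in _ - X]mulrC divfK ?mulf_neq0 ?pnatr_eq0 //.
    by have := sqr_ge0 (m - t); nra.
  have [_ [x hx <-] hxm] := sup_adherent e0 supA.
  by exists x; split=> //; rewrite he // ?rnorm_ge0.
have [x hx] := choice ex.
have [y hy] := compact_op_cluster cJ (fun k => (hx k).1).
have small (e : R) : 0 < e -> exists2 N : nat, N.+1%:R^-1 < e & forall k, (N <= k)%N -> k.+1%:R^-1 < e.
  move=> e0; have h : (Num.truncn e^-1).+1%:R^-1 < e.
    by rewrite invf_plt ?posrE ?ltr0n // truncnS_gt.
  exists (Num.truncn e^-1) => // k Nk; apply: le_lt_trans h.
  by rewrite lef_pV2 ?posrE ?ltr0n // ler_nat ltnS.
exists y.
  (* If y were zero, |J x_k| would fall below m/2 for some large k, although its square is close to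
     m^2. *)
  apply/eqP => y0; have e0 : 0 < Num.min (m / 2) 1 by rewrite lt_min divr_gt0 // ltr01.
  have m20 : 0 < m ^+ 2 / 2 by rewrite divr_gt0 ?exprn_gt0.
  have [N _ hN] := small _ m20.
  have [k Nk] := hy _ N e0; rewrite y0 subr0 lt_min => /andP[h _].
  have := (hx k).2; have := hN k Nk.
  have : rnorm (J (x k)) ^+ 2 < (m / 2) ^+ 2 by rewrite ltr_pXn2r ?nnegrE ?rnorm_ge0 // ltW // divr_gt0.
  move: (k.+1%:R^-1) => g; have := exprn_gt0 2 mgt; rewrite expr_div_n; lra.
apply/eqP; rewrite -subr_eq0 -rnorm_eq0 eq_le rnorm_ge0 andbT.
apply/ler_addgt0Pr => e e0; rewrite add0r.
have den : 0 < 3 * m ^+ 2 by rewrite mulr_gt0 ?exprn_gt0.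
(* The passage from J^2 y to m^2 y goes through J^3 w and m^2 J w, with an error of at most e/3 each
   time. The tolerance is squared in [g1] because [rnorm_selfadjoint_sub] bounds a square. *)
have g0 : 0 < e / (3 * m ^+ 2) by rewrite divr_gt0.
have g1 : 0 < (e / (3 * m ^+ 2)) ^+ 2 by rewrite exprn_gt0.
have [N _ hN] := small _ g1.
have [k Nk hk] := hy _ N g0; have {}hN := hN k Nk.
set w := x k in hk; have [hw hwm] := hx k.
have t1 : rnorm (J (J (J w)) - (m ^+ 2)%:C *: J w) <= m * (m * (e / (3 * m ^+ 2))).
  rewrite -[_ *: J w]opZ // -opB //; apply: (le_trans (hm _)); rewrite ler_wpM2l //.
  have mg0 : 0 <= m * (e / (3 * m ^+ 2)) by rewrite mulr_ge0 // ltW.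
  rewrite -(@ler_pXn2r _ 2) ?nnegrE ?rnorm_ge0 ?mg0 //.
  apply: le_trans (rnorm_selfadjoint_sub sJ hm m0 hw) _.
  rewrite exprMn ler_wpM2l ?sqr_ge0 // lerBlDr -lerBlDl ltW //.
  apply: lt_trans hwm; rewrite ltrD2l ltrN2; exact: hN.
have t2 : rnorm (J (J y) - J (J (J w))) <= m * (m * (e / (3 * m ^+ 2))).
  rewrite -!opB //; apply: (le_trans (hm _)); rewrite ler_wpM2l //.
  by apply: (le_trans (hm _)); rewrite ler_wpM2l // rnormBC ltW.
have t3 : rnorm ((m ^+ 2)%:C *: J w - (m ^+ 2)%:C *: y) <= m ^+ 2 * (e / (3 * m ^+ 2)).
  by rewrite -scalerBr rnormZ modulus_real ger0_norm ?sqr_ge0 // ler_wpM2l ?sqr_ge0 // ltW.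
have e3 : m ^+ 2 * (e / (3 * m ^+ 2)) = e / 3 by field; rewrite lt0r_neq0.
rewrite mulrA -expr2 e3 in t1 t2; rewrite e3 in t3.
apply: le_trans (rnorm_sub_le _ (J (J (J w))) _) _.
have := rnorm_sub_le (J (J (J w))) ((m ^+ 2)%:C *: J w) ((m ^+ 2)%:C *: y).
by lra.
Qed.

Definition orthosystem (u : nat -> H) : Prop :=
  forall i j, ip (u i) (u j) = ((i == j) && (u i != 0))%:R.

(* [u] and [lam] list the eigenvectors and eigenvalues of [J]; when [J] has
   finite rank, both are continued by zeros. *)
Record eigen_expansion J (u : nat -> H) (lam : nat -> R) : Prop := {
  expansion_ortho : orthosystem u;
  expansion_eigen : forall j, J (u j) = (lam j)%:C *: u j;
  expansion_neq0 : forall j, lam j != 0 -> u j != 0;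
  expansion_homo : {homo (fun j => `|lam j|) : i j / (i <= j)%N >-> j <= i};
  expansion_rest : forall m x,
    rnorm (J x - \sum_(j < m) ((lam j)%:C * ip x (u j)) *: u j) <= `|lam m| * rnorm x;
  expansion_lim : forall e, 0 < e -> exists m, `|lam m| < e
}.

Lemma rnorm_sub_proj2 x u : ip u u = (u != 0)%:R ->
  rnorm (x - ip x u *: u) ^+ 2 = rnorm x ^+ 2 - modulus (ip x u) ^+ 2.
Proof.
move=> hu; rewrite (rnormB2 hip) ipZr [Num.conj _ * _]mulrC modulusK rnormZ /=.
suff -> : (modulus (ip x u) * rnorm u) ^+ 2 = modulus (ip x u) ^+ 2 by ring.
have [->|u0] := eqVneq u 0; first by rewrite ip0r modulus0 mul0r.
rewrite exprMn; have -> : rnorm u ^+ 2 = 1; last by rewrite mulr1.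
by apply: (@complexI R); rewrite -(ipxx hip) hu u0.
Qed.

Lemma rnorm_sub_proj x u : ip u u = (u != 0)%:R -> rnorm (x - ip x u *: u) <= rnorm x.
Proof.
move=> hu; rewrite -(@ler_pXn2r _ 2) ?nnegrE ?rnorm_ge0 // rnorm_sub_proj2 //.
by rewrite lerBlDr lerDl sqr_ge0.
Qed.

Lemma ip_sub_projs u x (n k : nat) : orthosystem u ->
  ip (x - \sum_(i < n) ip x (u i) *: u i) (u k) = if (k < n)%N then 0 else ip x (u k).
Proof.
move=> ou; rewrite ipBl ip_suml.
have [kn|nk] := ltnP k n.
  rewrite (bigD1 (Ordinal kn)) //= big1 => [|i /eqP ik].
    rewrite ipZl ou eqxx addr0 /=; have [->|_] := eqVneq (u k) 0.
      by rewrite ip0r mul0r subrr.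
    by rewrite mulr1 subrr.
  rewrite ipZl ou; case: eqP => [e|_]; last by rewrite mulr0.
  by case: ik; apply/val_inj.
rewrite big1 ?subr0 // => i _; rewrite ipZl ou ltn_eqF ?mulr0 //.
exact: leq_trans (ltn_ord i) nk.
Qed.

Lemma rnorm_sub_projs2 u x n : orthosystem u ->
  rnorm (x - \sum_(i < n) ip x (u i) *: u i) ^+ 2 =
  rnorm x ^+ 2 - \sum_(i < n) modulus (ip x (u i)) ^+ 2.
Proof.
move=> ou; elim: n => [|n IH]; first by rewrite !big_ord0 !subr0.
rewrite !big_ord_recr /= !opprD !addrA -IH.
have := @ip_sub_projs u x n n ou; rewrite ltnn => e.
by rewrite -{1}e rnorm_sub_proj2 ?e // ou eqxx.
Qed.

Lemma bessel u x n : orthosystem u ->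
  \sum_(i < n) modulus (ip x (u i)) ^+ 2 <= rnorm x ^+ 2.
Proof. by move=> ou; rewrite -subr_ge0 -rnorm_sub_projs2 // sqr_ge0. Qed.

(** Deflation: a maximal eigenpair is split off and the construction is repeated on the remainder
    [Jn n], whose norm is [|lam n|]. *)
Lemma eigen_expansion_exists J : compact_op J -> selfadjoint ip J ->
  exists u lam, eigen_expansion J u lam.
Proof.
move=> cJ0 sJ0.
have /choice[f hf] : forall J, exists p : H * R, compact_op J -> selfadjoint ip J ->
    [/\ J p.1 = p.2%:C *: p.1, forall x, rnorm (J x) <= `|p.2| * rnorm x,
    p.2 != 0 -> rnorm p.1 = 1 & p.2 = 0 -> p.1 = 0].
  move=> J1; have [[c s]|ncs] := pselect (compact_op J1 /\ selfadjoint ip J1).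
    by have [p hp] := selfadjoint_max_eigenvector c s; exists p.
  by exists (0, 0) => c s; exfalso; apply: ncs.
pose step (K : H -> H) x := K x - ((f K).2%:C * ip x (f K).1) *: (f K).1.
pose Jn n := iter n step J.
pose u n := (f (Jn n)).1; pose lam n := (f (Jn n)).2.
have JnS n x : Jn n.+1 x = Jn n x - ((lam n)%:C * ip x (u n)) *: u n by [].
have csJ n : compact_op (Jn n) /\ selfadjoint ip (Jn n).
  elim: n => [//|n [cn sn]].
  have [h1 h2 h3 h4] := hf _ cn sn; rewrite -/(u n) -/(lam n) in h1 h2 h3 h4.
  have [[ln _] _] := cn.
  have uu : ip (u n) (u n) = (u n != 0)%:R.
    rewrite (ipxx hip); have [l0|l0] := eqVneq (lam n) 0.
      by rewrite h4 // rnorm0 eqxx expr0n.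
    by have -> : u n != 0; rewrite -?rnorm_eq0 h3 // ?oner_eq0 // expr1n.
  split; last first.
    by move=> x y; rewrite !JnS ipBl ipBr sn ipZl ipZr rmorphM /= conj_real (ipC ip) -!mulrA
      [ip (u n) y * _]mulrC.
  (* Removing the eigenpair amounts to projecting first, so compactness is inherited. *)
  have -> : Jn n.+1 = Jn n \o (fun x => x - ip x (u n) *: u n).
    by apply/funext => x; rewrite JnS compE (opB ln) (opZ ln) h1 scalerA [_ * (lam n)%:C]mulrC.
  apply: compact_op_comp => // [a x y|x]; last exact: rnorm_sub_proj.
  by rewrite ipDl ipZl scalerBr scalerDl opprD scalerA -!addrA; congr (_ + _); rewrite addrCA.
have P n : [/\ Jn n (u n) = (lam n)%:C *: u n, forall x, rnorm (Jn n x) <= `|lam n| * rnorm x,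
    lam n != 0 -> rnorm (u n) = 1 & lam n = 0 -> u n = 0].
  by have [cn sn] := csJ n; exact: hf.
have u0E n : (u n != 0) = (lam n != 0).
  have [_ _ h3 h4] := P n; have [/h4 ->|/h3 h] := eqVneq (lam n) 0; first by rewrite eqxx.
  by rewrite -rnorm_eq0 h oner_eq0.
have uu n : ip (u n) (u n) = (u n != 0)%:R.
  have [_ _ h3 h4] := P n; rewrite (ipxx hip) u0E.
  have [/h4 ->|/h3 ->] := eqVneq (lam n) 0; first by rewrite rnorm0 expr0n.
  by rewrite expr1n.
have ortho_of i j : Jn j (u i) = 0 -> ip (u i) (u j) = 0.
  move=> h; have [h1 _ _ h4] := P j.
  have [l0|l0] := eqVneq (lam j) 0; first by rewrite h4 // ip0r.
  have := (csJ j).2 (u i) (u j); rewrite h ip0l h1 ipZr conj_real => /esym/eqP.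
  by rewrite mulf_eq0 (inj_eq (@complexI R) _ 0) (negPf l0) /= => /eqP.
have Ju0 i j : (i < j)%N -> Jn j (u i) = 0.
  elim: j => // j IH; rewrite ltnS leq_eqVlt => /orP[/eqP ->|/IH h].
    have [h1 _ _ h4] := P j; rewrite JnS h1 uu u0E.
    have [l0|l0] := eqVneq (lam j) 0; first by rewrite h4 // !scaler0 subr0.
    by rewrite mulr1 subrr.
  by rewrite JnS h (ortho_of _ _ h) mulr0 scale0r subr0.
have ou : orthosystem u.
  move=> i j; case: (ltngtP i j) => [ij|ji|->]; last by rewrite uu.
  - by rewrite ortho_of // Ju0.
  - by rewrite -(ipC ip) ortho_of ?rmorph0 // Ju0.
have JnE m x : Jn m x = J x - \sum_(j < m) ((lam j)%:C * ip x (u j)) *: u j.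
  elim: m => [|m IH]; first by rewrite big_ord0 subr0.
  by rewrite JnS IH big_ord_recr /= opprD addrA.
have Ju j : J (u j) = (lam j)%:C *: u j.
  have [h1 _ _ _] := P j; rewrite -h1 JnE big1 ?subr0 // => i _.
  by rewrite ou gtn_eqF //= mulr0 scale0r.
have homoS n : `|lam n.+1| <= `|lam n|.
  have [l0|l0] := eqVneq (lam n.+1) 0; first by rewrite l0 normr0.
  have [h1 _ h3 _] := P n.+1; have [g1 g2 _ _] := P n.
  have : rnorm (Jn n.+1 (u n.+1)) <= `|lam n| * rnorm (u n.+1).
    rewrite JnS ou gtn_eqF //= mulr0 scale0r subr0; exact: g2.
  by rewrite h1 rnormZ modulus_real h3 // !mulr1.
exists u, lam; split => //.
- by move=> j; rewrite u0E.
- move=> i j; elim: j => [|j IH]; first by rewrite leqn0 => /eqP ->.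
  rewrite leq_eqVlt ltnS => /orP[/eqP -> //|/IH]; exact: le_trans.
- by move=> m x; rewrite -JnE; have [_ h _ _] := P m; exact: h.
(* If all [|lam m|] were at least [e], the vectors J u_k would have mutual distances at least [e]
   and no cluster point. *)
- move=> e e0; apply: contrapT => /forallNP hl.
  have {}hl m : e <= `|lam m| by rewrite leNgt; apply/negP; exact: hl.
  have l0 m : lam m != 0 by rewrite -normr_gt0 (lt_le_trans e0).
  have un m : rnorm (u m) = 1 by have [_ _ h _] := P m; exact: h.
  have [y hy] := compact_op_cluster cJ0 (fun k => eq_ind_r (fun r => r <= 1) (lexx 1) (un k)).
  have e20 : 0 < e / 2 by rewrite divr_gt0.
  have [k1 _ h1] := hy _ 0%N e20; have [k2 k12 h2] := hy _ k1.+1 e20.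
  have : rnorm (J (u k1) - J (u k2)) < e.
    apply: le_lt_trans (rnorm_sub_le _ y _) _; rewrite [rnorm (y - _)]rnormBC; lra.
  rewrite -(@ltr_pXn2r _ 2) ?nnegrE ?rnorm_ge0 ?(ltW e0) // !Ju (rnormB2 hip).
  rewrite ipZl ipZr ou ltn_eqF //= !mulr0 subr0 !rnormZ !un !mulr1 !modulus_real.
  have : e ^+ 2 <= `|lam k1| ^+ 2 by rewrite ler_pXn2r ?nnegrE ?(ltW e0).
  have := sqr_ge0 `|lam k2|; lra.
Qed.

End SpectralTheorem.

(** * Singular numbers *)

Section SingularNumbers.
Context (R : realType) (H : completeNormedModType R[i]).
Context (ip : {dot H for (@Num.conj R[i])}).
Hypothesis hip : hilbert ip.
Implicit Types (T J : H -> H) (x y z : H).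

(** Counting: if s_j > s'_j, the values s_0, ..., s_j are positive and exceed s'_j. By equality of
    multiplicities they occur in s' at distinct positions, all below j; but there are only j of
    these. *)
Lemma is_snumbers_le T (s s' : nat -> R) :
  is_snumbers ip T s -> is_snumbers ip T s' -> forall j, s j <= s' j.
Proof.
move=> [sd s0 hs] [sd' s0' hs'] j; rewrite leNgt; apply/negP => lt_sj.
have pos (i : 'I_j.+1) : 0 < s i.
  apply: le_lt_trans (s0' j) _; apply: lt_le_trans lt_sj _.
  by apply: sd; rewrite -ltnS.
have /choice[h hh] : forall mu : R, exists h : 'I_j.+1 -> nat, 0 < mu ->
    (forall i : 'I_j.+1, s i = mu -> s' (h i) = mu) /\
    (forall i i' : 'I_j.+1, s i = mu -> s i' = mu -> h i = h i' -> i = i').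
  move=> mu; have [mu0|mu0] := ltP 0 mu; last by exists (fun=> 0%N).
  pose A := [set i : 'I_j.+1 | s i == mu]%SET.
  have [A0|[i0 i0A]] := set_0Vmem A.
    have noA i : s (i : 'I_j.+1) <> mu.
      by move=> /eqP si; have : i \in A by [rewrite inE]; rewrite A0 finset.in_set0.
    by exists (fun=> 0%N) => _; split=> [i /noA|i i' /noA].
  (* Positions of [mu] in [s] give as many independent eigenvectors, and these as many positions in
     [s']. *)
  have : exists2 g : 'I_#|A| -> nat, injective g & forall i, s' (g i) = mu.
    apply/hs' => //; apply/hs => //; exists (fun a => val (enum_val a)).
      by move=> a b /val_inj/enum_val_inj.
    by move=> a; have := enum_valP a; rewrite inE => /eqP.
  move=> [g ginj gmu].
  exists (fun i => g (enum_rank_in i0A i)) => _; split=> [i _|i i' hi hi' /ginj].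
    exact: gmu.
  by apply: enum_rank_in_inj; rewrite inE; apply/eqP.
pose f (i : 'I_j.+1) := h (s i) i.
have fs i : s' (f i) = s i by have [h1 _] := hh _ (pos i); exact: h1.
have finj : injective f.
  move=> i i' fii; have e : s i' = s i by rewrite -!fs fii.
  have [_ h2] := hh _ (pos i); apply: h2 => //.
  by move: fii; rewrite /f e.
have fj i : (f i < j)%N.
  rewrite ltnNge; apply/negP => /sd'; rewrite fs leNgt => /negP; apply.
  by apply: lt_le_trans lt_sj _; apply: sd; rewrite -ltnS.
have inj : injective (fun i => Ordinal (fj i)) by move=> i i' /(congr1 val)/finj.
by have := leq_card _ inj; rewrite !card_ord ltnn.
Qed.

Lemma snumberE T s : is_snumbers ip T s -> snumber ip T = s.
Proof.
move=> hs; have hs' : is_snumbers ip T (snumber ip T).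
  exact: (xgetPex (fun=> 0) (ex_intro [set s | is_snumbers ip T s] s hs)).
apply/funext => j; apply/eqP; rewrite eq_le.
by rewrite (is_snumbers_le hs' hs) (is_snumbers_le hs hs').
Qed.

Section Expansion.
Context (J : H -> H) (u : nat -> H) (lam : nat -> R).
Hypotheses (cJ : compact_op J) (sJ : selfadjoint ip J) (eJ : eigen_expansion ip J u lam).

Let ou := expansion_ortho eJ.
Let lJ : linear J := cJ.1.1.

(** Selfadjointness kills the coefficients with [|lam j| != mu]. What is left of [x] after [M] terms
    is again in the eigenspace of J^2 for mu^2, but there [J] is bounded by [|lam M| < mu]; so it is
    zero. *)
Lemma eigenvector_expansion (mu : R) (x : H) (M : nat) : 0 < mu -> `|lam M| < mu ->
  J (J x) = (mu ^+ 2)%:C *: x ->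
  x = \sum_(j < M | `|lam j| == mu) ip x (u j) *: u j.
Proof.
move=> mu0 lamM JJx.
have c0 j : `|lam j| != mu -> ip x (u j) = 0.
  move=> lj; have : ip (J (J x)) (u j) = ip x (J (J (u j))) by rewrite !sJ.
  rewrite JJx !(expansion_eigen eJ) (opZ lJ) (expansion_eigen eJ) scalerA ipZl ipZr.
  rewrite -rmorphM conj_real -expr2 => /eqP; rewrite -subr_eq0 -mulrBl -rmorphB.
  rewrite mulf_eq0 (inj_eq (@complexI R) _ 0) subr_eq0 -(real_normK (num_real (lam j))).
  by rewrite eqrXn2 ?(ltW mu0) // eq_sym (negPf lj) => /eqP.
pose y := x - \sum_(j < M) ip x (u j) *: u j.
have y0 (j : 'I_M) : ip y (u j) = 0 by rewrite ip_sub_projs // ltn_ord.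
have Jy0 (j : 'I_M) : ip (J y) (u j) = 0.
  by rewrite sJ (expansion_eigen eJ) ipZr y0 mulr0.
have Jle z : (forall j : 'I_M, ip z (u j) = 0) -> rnorm (J z) <= `|lam M| * rnorm z.
  move=> hz; have := expansion_rest eJ M z.
  by rewrite big1 ?subr0 // => j _; rewrite hz mulr0 scale0r.
have JJy : J (J y) = (mu ^+ 2)%:C *: y.
  rewrite /y !(opB lJ) !(op_sum lJ) JJx scalerBr; congr (_ - _).
  rewrite scaler_sumr; apply: eq_bigr => j _.
  rewrite !(opZ lJ) (expansion_eigen eJ) (opZ lJ) (expansion_eigen eJ) !scalerA.
  have [e|/c0 ->] := eqVneq `|lam j| mu; last by rewrite !mul0r mulr0 scale0r.
  by rewrite -mulrA -rmorphM mulrC -expr2 -(real_normK (num_real (lam j))) e.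
have yy : y = 0.
  apply/eqP; rewrite -rnorm_eq0; apply: contraT => ny.
  have ny0 : 0 < rnorm y by rewrite lt_def rnorm_ge0 ny.
  have : rnorm (J (J y)) <= `|lam M| * (`|lam M| * rnorm y).
    by apply: le_trans (Jle _ Jy0) _; rewrite ler_wpM2l // Jle.
  rewrite JJy rnormZ modulus_real ger0_norm ?sqr_ge0 // mulrA -expr2 ler_pM2r //.
  by rewrite ler_pXn2r ?nnegrE ?(ltW mu0) // leNgt lamM.
move/eqP: yy; rewrite subr_eq0 => /eqP {1}->; rewrite [RHS]big_mkcond /=.
by apply: eq_bigr => j _; case: ifPn => // /c0 ->; rewrite scale0r.
Qed.

(** As [J] is selfadjoint, the condition concerns J^2, whose eigenspace for mu^2 is spanned by the
    [u j] with [|lam j| = mu]. *)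
Lemma expansion_is_snumbers : is_snumbers ip J (fun j => `|lam j|).
Proof.
split=> // [|mu m mu0]; first exact: expansion_homo eJ.
rewrite (selfadjoint_adjoint hip sJ); split=> [[e indep ee]|[g ginj gmu]].
- have [M lamM] := expansion_lim eJ mu0.
  pose A := [set j : 'I_M | `|lam j| == mu]%SET.
  have eE i : e i = \sum_(a < #|A|) ip (e i) (u (enum_val a)) *: u (enum_val a).
    rewrite {1}(eigenvector_expansion mu0 lamM (ee i)).
    rewrite (eq_bigl (fun j => j \in A)) => [|j]; last by rewrite inE.
    by rewrite big_enum_val.
  have mA : (m <= #|A|)%N.
    rewrite leqNgt; apply/negP => Am.
    pose B : 'M[R[i]]_(m, #|A|) := \matrix_(i, a) ip (e i) (u (@enum_val _ (mem A) a)).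
    (* With more vectors than spanning elements, the coefficient matrix has a left kernel, and this
       gives a linear relation among the [e i]. *)
    have : kermx B != 0.
      rewrite -mxrank_eq0 mxrank_ker subn_eq0 -ltnNge.
      exact: leq_ltn_trans (rank_leq_col B) Am.
    case/rowV0Pn => c cker /eqP; apply; apply/rowP => i; rewrite mxE.
    apply: (indep (fun i => c 0 i)).
    under eq_bigr do rewrite eE scaler_sumr.
    rewrite exchange_big big1 //= => a _.
    under eq_bigr do rewrite scalerA.
    rewrite -scaler_suml; have /sub_kermxP/rowP/(_ a) := cker.
    rewrite !mxE => ca; rewrite (_ : \sum_(i < m) _ = 0) ?scale0r // -[RHS]ca.
    by apply: eq_bigr => k _; rewrite mxE.
  exists (fun i => val (enum_val (widen_ord mA i))) => [i j /val_inj/enum_val_inj|i].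
    by move/(congr1 val) => /= ij; apply: val_inj.
  by have := enum_valP (widen_ord mA i); rewrite inE => /eqP.
- have un0 i : u (g i) != 0.
    by apply: (expansion_neq0 eJ); rewrite -normr_gt0 gmu.
  exists (fun i => u (g i)) => [c hc i|i].
    have := congr1 (fun z => ip z (u (g i))) hc; rewrite ip_suml ip0l (bigD1 i) //= big1.
      by rewrite addr0 ipZl ou eqxx un0 mulr1.
    by move=> k ki; rewrite ipZl ou (inj_eq ginj) (negPf ki) mulr0.
  rewrite (expansion_eigen eJ) (opZ lJ) (expansion_eigen eJ) scalerA -rmorphM -expr2.
  by rewrite -(real_normK (num_real (lam (g i)))) gmu.
Qed.

Lemma snumber_expansion : snumber ip J = (fun j => `|lam j|).
Proof. exact: snumberE expansion_is_snumbers. Qed.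

End Expansion.
End SingularNumbers.

(** * Triangular compressions of a Volterra operator *)

Section VolterraCompression.
Context (R : realType) (H : completeNormedModType R[i]).
Context (ip : {dot H for (@Num.conj R[i])}).
Hypothesis hip : hilbert ip.
Implicit Types (T : H -> H) (x y z : H).

Lemma volterra_eigen0 T (a : R[i]) x : volterra T -> a != 0 -> T x = a *: x -> x = 0.
Proof.
move=> [_ sp] a0 Tx; apply/eqP; apply: contraT => x0.
have : ~ spectrum T a by rewrite sp => /eqP; exact/negP.
move=> /contrapT[S [lS _] [hS _]].
by have := hS x; rewrite Tx subrr op0 // => e; rewrite e eqxx in x0.
Qed.

(** Pythagoras at the Rayleigh quotient. It lets one fixed coefficient replace approximate
    eigenvalues that change with the accuracy. *)
Lemma rnorm_sub_min z y a : y != 0 ->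
  rnorm (z - a *: y) ^+ 2 = rnorm (z - (ip z y / ip y y) *: y) ^+ 2 +
    (modulus (ip z y / ip y y - a) * rnorm y) ^+ 2.
Proof.
move=> y0; set b := ip z y / ip y y.
have iy0 : ip y y != 0.
  by rewrite (ipxx hip) (inj_eq (@complexI R) _ 0) sqrf_eq0 rnorm_eq0.
have -> : z - a *: y = (z - b *: y) + (b - a) *: y by rewrite scalerBl addrA subrK.
rewrite (rnormD2 hip) ipZr ipBl ipZl /b divfK // subrr mulr0 /= mulr0 addr0.
by rewrite rnormZ.
Qed.

(** Otherwise there are unit vectors x_k and |a_k| >= e with T x_k - a_k x_k tending to 0. A cluster
    point y of T x_k is then an eigenvector with nonzero eigenvalue. *)
Lemma approximate_eigenvalue T (e : R) : compact_op T ->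
  (forall a x, a != 0 -> T x = a *: x -> x = 0) -> 0 < e ->
  exists2 d : R, 0 < d & forall (a : R[i]) x, e <= modulus a ->
    rnorm (T x - a *: x) <= d * rnorm x -> x = 0.
Proof.
move=> cT noeig e0; apply: contrapT => hn.
have [bT _] := cT; have [lT _] := bT; have [K K0 hK] := bounded_op_bound bT.
have ex (k : nat) : exists p : R[i] * H, [/\ e <= modulus p.1, rnorm p.2 = 1 &
    rnorm (T p.2 - p.1 *: p.2) <= k.+1%:R^-1].
  apply: contrapT => hk; apply: hn; exists (k.+1%:R^-1); first by rewrite invr_gt0 ltr0n.
  move=> a x ea hx; apply/eqP; apply: contraT => x0; case: hk.
  have nx : 0 < rnorm x by rewrite lt_def rnorm_ge0 rnorm_eq0 x0.
  exists (a, (rnorm x)^-1%:C *: x); split => //=.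
    by rewrite rnormZ modulus_real ger0_norm ?invr_ge0 ?rnorm_ge0 // mulVf // lt0r_neq0.
  rewrite (opZ lT) scalerA [a * _]mulrC -scalerA -scalerBr rnormZ modulus_real.
  by rewrite ger0_norm ?invr_ge0 ?rnorm_ge0 // mulrC ler_pdivrMr.
have [p hp] := choice ex.
have n1 k : rnorm (p k).2 <= 1 by have [_ -> _] := hp k.
have [y hy] := compact_op_cluster cT n1.
(* Where T x is close both to y and to a x, applying [T] shows that T y is close to a y. As |x| = 1,
   the norm of y is close to |a|. *)
have near (g : R) : 0 < g -> exists a : R[i], e <= modulus a /\
    modulus a <= rnorm y + 2 * g /\ e - 2 * g <= rnorm y /\
    rnorm (T y - a *: y) <= g * (2 * K + rnorm y + 2 * g).
  move=> g0.
  have hN : (Num.truncn g^-1).+1%:R^-1 < g by rewrite invf_plt ?posrE ?ltr0n // truncnS_gt.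
  have [k Nk hk] := hy _ (Num.truncn g^-1) g0; have [ea nx hx] := hp k.
  set a := (p k).1 in ea hx *; set x := (p k).2 in nx hx hk *.
  have {}hx : rnorm (T x - a *: x) <= g.
    apply: (le_trans hx); apply/ltW/(le_lt_trans _ hN).
    by rewrite lef_pV2 ?posrE ?ltr0n // ler_nat ltnS.
  have nax : rnorm (a *: x) = modulus a by rewrite rnormZ nx mulr1.
  have h1 := rnorm_sub_le (a *: x) (T x) 0; rewrite !subr0 nax rnormBC in h1.
  have h2 := rnorm_sub_le (T x) y 0; rewrite !subr0 in h2.
  have ha : modulus a <= rnorm y + 2 * g by lra.
  exists a; split => //; split=> //; split; first by lra.
  have t1 : rnorm (T y - T (T x)) <= K * g.
    by rewrite -(opB lT); apply: le_trans (hK _) _; rewrite ler_wpM2l // rnormBC ltW.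
  have t2 : rnorm (T (T x) - a *: T x) <= K * g.
    by rewrite -(opZ lT) -(opB lT); apply: le_trans (hK _) _; rewrite ler_wpM2l.
  have t3 : rnorm (a *: T x - a *: y) <= modulus a * g.
    by rewrite -scalerBr rnormZ ler_wpM2l ?modulus_ge0 // ltW.
  have t4 : modulus a * g <= (rnorm y + 2 * g) * g by rewrite ler_wpM2r // ltW.
  have := rnorm_sub_le (T y) (T (T x)) (a *: y).
  have := rnorm_sub_le (T (T x)) (a *: T x) (a *: y).
  rewrite -/a; nra.
have ny : 0 < rnorm y.
  have [|a [_ [_ [h _]]]] := near (e / 4); first by rewrite divr_gt0.
  lra.
have y0 : y != 0 by rewrite -rnorm_eq0 gt_eqF.
pose c := 2 * K + rnorm y + 2.
have c0 : 0 < c by rewrite /c; lra.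
have near' (g : R) : 0 < g -> exists2 a : R[i], e <= modulus a &
    rnorm (T y - a *: y) <= g.
  move=> g0; have [|a [ea [_ [_ ha]]]] := near (Num.min 1 (g / c)).
    by rewrite lt_min ltr01 divr_gt0.
  exists a => //; apply: (le_trans ha).
  apply: (@le_trans _ _ (g / c * c)); last by rewrite divfK // lt0r_neq0.
  apply: ler_pM; rewrite ?le_min ?ler01 ?(ltW (divr_gt0 g0 c0)) ?ge_min ?lexx ?orbT //.
    by rewrite !addr_ge0 ?mulr_ge0 ?rnorm_ge0 // le_min ler01 (ltW (divr_gt0 g0 c0)).
  by rewrite /c lerD2l -[leRHS]mulr1 ler_wpM2l // ge_min lexx.
set b := ip (T y) y / ip y y.
have Ty : T y = b *: y.
  apply/eqP; rewrite -subr_eq0 -rnorm_eq0 eq_le rnorm_ge0 andbT.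
  apply/ler_addgt0Pr => g g0; rewrite add0r; have [a _ ha] := near' g g0.
  apply: le_trans ha; rewrite -(@ler_pXn2r _ 2) ?nnegrE ?rnorm_ge0 //.
  by rewrite (rnorm_sub_min _ a y0) lerDl sqr_ge0.
(* For b = 0 the error T y - a y would have norm at least e |y|, against the bound e |y| / 2. *)
have b0 : b != 0.
  have [|a ea ha] := near' (e * rnorm y / 2); first by rewrite divr_gt0 ?mulr_gt0.
  apply/eqP => b0; have := rnorm_sub_min (T y) a y0.
  rewrite -/b b0 add0r modulusN => h.
  have : (modulus a * rnorm y) ^+ 2 <= (e * rnorm y / 2) ^+ 2.
    apply: (@le_trans _ _ (rnorm (T y - a *: y) ^+ 2)).
      by rewrite h lerDr sqr_ge0.
    by rewrite ler_pXn2r ?nnegrE ?rnorm_ge0 // !mulr_ge0 // ltW.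
  rewrite ler_pXn2r ?nnegrE ?mulr_ge0 ?modulus_ge0 ?rnorm_ge0 ?(ltW e0) //.
  rewrite mulrAC ler_pM2r //; lra.
by move: (noeig b y b0 Ty) => yy; rewrite yy eqxx in y0.
Qed.

(** The vectors from position [N] on are zero, so that the whole family is an orthosystem. *)
Definition orthonormal_upto (N : nat) (v : nat -> H) : Prop :=
  forall i j, ip (v i) (v j) = ((i == j) && (i < N)%N)%:R.

Definition ortho_proj (v : nat -> H) (N : nat) x : H := \sum_(k < N) ip x (v k) *: v k.

Lemma orthonormal_ortho N v : orthonormal_upto N v -> orthosystem ip v.
Proof.
move=> ov i j; rewrite ov; case: eqVneq => //= _; congr (_ %:R).
rewrite -rnorm_eq0 -sqrf_eq0 -(inj_eq (@complexI R)) -(ipxx hip) ov eqxx /=.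
by case: ltnP => _; rewrite ?eqxx // oner_eq0.
Qed.

Lemma rnorm_sub_projs_le v N x : orthosystem ip v -> rnorm (x - ortho_proj v N x) <= rnorm x.
Proof.
move=> ov; elim: N => [|N IH]; first by rewrite /ortho_proj big_ord0 subr0.
apply: le_trans IH; rewrite /ortho_proj big_ord_recr /= opprD addrA.
have := @ip_sub_projs _ _ ip v x N N ov; rewrite ltnn => {1}<-.
by apply: rnorm_sub_proj => //; rewrite ov eqxx.
Qed.

Lemma proj_sub v N x y : ortho_proj v N (x - y) = ortho_proj v N x - ortho_proj v N y.
Proof. by rewrite /ortho_proj -sumrB; apply: eq_bigr => k _; rewrite ipBl scalerBl. Qed.

Lemma rnorm_sub_projs_min v N z f : orthosystem ip v -> ortho_proj v N f = f ->
  rnorm (z - ortho_proj v N z) <= rnorm (z - f).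
Proof.
move=> ov hf; have := @rnorm_sub_projs_le v N (z - f) ov.
by rewrite proj_sub hf opprB addrA subrK.
Qed.

(** One Gram-Schmidt step, which adds nothing if [w] lies in the span already. Size and family form
    a pair so that the step can be iterated. *)
Lemma orthonormal_extend N v w : orthonormal_upto N v ->
  exists p : nat * (nat -> H), [/\ orthonormal_upto p.1 p.2, ortho_proj p.2 p.1 w = w &
    forall x, ortho_proj v N x = x -> ortho_proj p.2 p.1 x = x].
Proof.
move=> ov; have oo := orthonormal_ortho ov.
pose w' := w - ortho_proj v N w.
have [w0|w0] := eqVneq w' 0.
  by exists (N, v); split => //=; apply/esym/eqP; rewrite -subr_eq0 -/w' w0.
have nw : 0 < rnorm w' by rewrite lt_def rnorm_ge0 rnorm_eq0 w0.
pose q := (rnorm w')^-1%:C *: w'.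
pose v' k := if k == N then q else v k.
have v0 k : (N <= k)%N -> v k = 0.
  move=> Nk; apply/eqP; rewrite -rnorm_eq0 -sqrf_eq0 -(inj_eq (@complexI R)) -(ipxx hip) ov.
  by rewrite eqxx ltnNge Nk.
have w'v k : ip w' (v k) = 0.
  rewrite ip_sub_projs //; case: ltnP => // Nk; by rewrite v0 // ip0r.
have qv k : ip q (v k) = 0 by rewrite ipZl w'v mulr0.
have vq k : ip (v k) q = 0 by rewrite -(ipC ip) qv rmorph0.
have qq : ip q q = 1.
  rewrite (ipxx hip) rnormZ modulus_real ger0_norm ?invr_ge0 ?rnorm_ge0 //.
  by rewrite mulVf ?expr1n // lt0r_neq0.
have projS x : ortho_proj v' N.+1 x = ortho_proj v N x + ip x q *: q.
  rewrite /ortho_proj big_ord_recr /=; congr (_ + _); last by rewrite /v' eqxx.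
  by apply: eq_bigr => k _; rewrite /v' ltn_eqF.
exists (N.+1, v'); split => /=.
- move=> i j; rewrite /v'; case: (boolP (i == N)) => [/eqP ->|iN]; case: (boolP (j == N)) => [/eqP ->|jN].
  + by rewrite qq eqxx ltnSn.
  + by rewrite qv eq_sym (negPf jN).
  + by rewrite vq (negPf iN).
  + by rewrite ov [(i < N.+1)%N]ltnS [(i <= N)%N]leq_eqVlt (negPf iN).
- rewrite projS; have -> : ip w q *: q = w'; last by rewrite /w' addrC subrK.
  have -> : w = w' + ortho_proj v N w by rewrite /w' subrK.
  rewrite ipDl /ortho_proj ip_suml big1 => [|k _]; last by rewrite ipZl vq mulr0.
  rewrite addr0 -/(ortho_proj v N w) /q ipZr conj_real (ipxx hip) scalerA -!rmorphM /=.
  rewrite -/w' [X in X%:C](_ : _ = 1) ?scale1r //.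
  by field; rewrite lt0r_neq0.
- move=> x hx; rewrite projS hx; suff -> : ip x q = 0 by rewrite scale0r addr0.
  by rewrite -hx /ortho_proj ip_suml big1 // => k _; rewrite ipZl vq mulr0.
Qed.

Lemma orthonormal_span (n : nat) (f : nat -> H) :
  exists p : nat * (nat -> H), orthonormal_upto p.1 p.2 /\
    forall i, (i < n)%N -> ortho_proj p.2 p.1 (f i) = f i.
Proof.
elim: n => [|n [[N v] /= [ov hv]]].
  by exists (0%N, fun=> 0); split=> // i j /=; rewrite ip0l ltn0 andbF.
have [[N' v'] /= [ov' h1 h2]] := orthonormal_extend (f n) ov.
exists (N', v'); split=> //= i; rewrite ltnS leq_eqVlt => /orP[/eqP -> //|/hv]; exact: h2.
Qed.

(** Were there no such space, every candidate could be enlarged by some T x_k at distance more than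
    [d] from it, with |x_k| <= 1. These vectors would be more than [d] apart, against
    compactness. *)
Lemma compact_op_compression T (n : nat) (f : nat -> H) (d : R) : compact_op T -> 0 < d ->
  exists N v, [/\ orthonormal_upto N v, forall i, (i < n)%N -> ortho_proj v N (f i) = f i &
    forall x, rnorm (T x - ortho_proj v N (T x)) <= d * rnorm x].
Proof.
move=> cT d0; have [bT _] := cT; have [lT _] := bT; apply: contrapT => hn.
pose P (p : nat * (nat -> H)) := orthonormal_upto p.1 p.2 /\
    forall i, (i < n)%N -> ortho_proj p.2 p.1 (f i) = f i.
have /choice[F hF] : forall p, exists q : H * (nat * (nat -> H)), P p ->
    [/\ P q.2, rnorm q.1 <= 1, d < rnorm (T q.1 - ortho_proj p.2 p.1 (T q.1)),
      ortho_proj q.2.2 q.2.1 (T q.1) = T q.1 &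
      forall x, ortho_proj p.2 p.1 x = x -> ortho_proj q.2.2 q.2.1 x = x].
  move=> [N v]; have [[/= ov hv]|nP] := pselect (P (N, v)); last by exists (0, (N, v)).
  have [x hx] : exists x, d * rnorm x < rnorm (T x - ortho_proj v N (T x)).
    apply: contrapT => hx; apply: hn; exists N, v; split=> // x.
    by rewrite leNgt; apply/negP => h; apply: hx; exists x.
  have x0 : x != 0.
    apply/eqP => x0; move: hx; rewrite x0 op0 // rnorm0 mulr0 /ortho_proj big1 ?subr0 ?rnorm0 ?ltxx //.
    by move=> k _; rewrite ip0l scale0r.
  have nx : 0 < rnorm x by rewrite lt_def rnorm_ge0 rnorm_eq0 x0.
  pose y := (rnorm x)^-1%:C *: x.
  have [q [q1 q2 q3]] := orthonormal_extend (T y) ov.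
  exists (y, q) => _; split => //=.
  - by split=> // i /hv; exact: q3.
  - by rewrite rnormZ modulus_real ger0_norm ?invr_ge0 ?rnorm_ge0 // mulVf // lt0r_neq0.
  - have -> : T y - ortho_proj v N (T y) = (rnorm x)^-1%:C *: (T x - ortho_proj v N (T x)).
      rewrite /y (opZ lT) scalerBr; congr (_ - _); rewrite /ortho_proj scaler_sumr.
      by apply: eq_bigr => k _; rewrite ipZl scalerA.
    rewrite rnormZ modulus_real ger0_norm ?invr_ge0 ?rnorm_ge0 // mulrC.
    by rewrite ltr_pdivlMr.
have [p0 hp0] := orthonormal_span n f.
pose st k := iter k (fun p => (F p).2) p0.
have stP k : P (st k).
  by elim: k => [//|k /hF[h _ _ _ _]].
pose x k := (F (st k)).1.
have hx k : [/\ rnorm (x k) <= 1, d < rnorm (T (x k) - ortho_proj (st k).2 (st k).1 (T (x k))),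
    ortho_proj (st k.+1).2 (st k.+1).1 (T (x k)) = T (x k) &
    forall z, ortho_proj (st k).2 (st k).1 z = z -> ortho_proj (st k.+1).2 (st k.+1).1 z = z].
  by have [_ h1 h2 h3 h4] := hF _ (stP k).
have fixed i k : (i < k)%N -> ortho_proj (st k).2 (st k).1 (T (x i)) = T (x i).
  elim: k => // k IH; have [_ _ h3 _] := hx i; have [_ _ _ h4] := hx k.
  by rewrite ltnS leq_eqVlt => /orP[/eqP <- //|/IH]; exact: h4.
have [y hy] := compact_op_cluster cT (fun k => let: And4 h _ _ _ := hx k in h).
have d20 : 0 < d / 2 by rewrite divr_gt0.
have [i _ hi] := hy _ 0%N d20; have [k ik hk] := hy _ i.+1 d20.
have [_ h2 _ _] := hx k.
have := rnorm_sub_projs_min (T (x k)) (orthonormal_ortho (stP k).1) (fixed _ _ ik).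
have := rnorm_sub_le (T (x k)) y (T (x i)); rewrite [rnorm (y - _)]rnormBC.
by lra.
Qed.

(** Schur's theorem for the matrix of the compression; the change of basis is unitary and keeps the
    projection. *)
Lemma orthonormal_upto_triangular T N v : linear T -> orthonormal_upto N v ->
  exists w, [/\ orthonormal_upto N w, forall x, ortho_proj w N x = ortho_proj v N x &
    forall k l, (k < l < N)%N -> ip (T (w k)) (w l) = 0].
Proof.
move=> lT ov; case: N ov => [|n] ov.
  exists v; split=> // k l; by rewrite ltn0 andbF.
set N := n.+1 in ov *.
pose A : 'M[R[i]]_N := \matrix_(i, j) ip (T (v i)) (v j).
have [//|P Pu PA] := @Schur _ N A.
have PP : P *m (P^T ^ Num.conj)%sesqui = 1%:M by exact/unitarymxP.
have PP' : (P^T ^ Num.conj)%sesqui *m P = 1%:M by exact: mulmx1C.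
have trigE : is_trig_mx (P *m A *m (P^T ^ Num.conj)%sesqui) by rewrite -conjymx.
pose w k := if (k < N)%N then \sum_(j < N) P (inord k) j *: v j else 0.
have wE (i : 'I_N) : w i = \sum_(j < N) P i j *: v j by rewrite /w ltn_ord inord_val.
have ip_wr x (i : 'I_N) : ip x (w i) = \sum_(j < N) Num.conj (P i j) * ip x (v j).
  by rewrite wE ip_sumr; apply: eq_bigr => j _; rewrite ipZr.
exists w; split.
- move=> k l; case: (ltnP k N) => kN; last by rewrite {1}/w ltnNge kN ip0l andbF.
  case: (ltnP l N) => lN; last first.
    by rewrite [w l]/w ltnNge lN ip0r ltn_eqF // (leq_trans kN).
  have := ip_wr (w k) (Ordinal lN); rewrite /= => ->.
  have -> : w k = w (Ordinal kN) by [].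
  have -> : ((k == l) && true)%:R = (1%:M : 'M[R[i]]_N) (Ordinal kN) (Ordinal lN).
    by rewrite mxE andbT.
  rewrite -PP mxE; apply: eq_bigr => j _; rewrite !mxE mulrC; congr (_ * _).
  rewrite wE ip_suml (bigD1 j) //= big1 => [|i ij]; last first.
    by rewrite ipZl ov (negPf (_ : (i : nat) != j)) ?mulr0.
  by rewrite ipZl ov eqxx ltn_ord addr0 mulr1.
- move=> x; rewrite /ortho_proj.
  transitivity (\sum_(i < N) \sum_(j < N) \sum_(m < N)
      ((Num.conj (P i j) * P i m) * ip x (v j)) *: v m).
    apply: eq_bigr => i _; rewrite ip_wr wE scaler_suml; apply: eq_bigr => j _.
    rewrite scaler_sumr; apply: eq_bigr => m _; rewrite scalerA.
    by rewrite mulrAC.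
  rewrite exchange_big /=; apply: eq_bigr => j _; rewrite exchange_big /=.
  rewrite (bigD1 j) //= [X in _ + X]big1 => [|m mj].
    rewrite addr0 -scaler_suml -mulr_suml.
    have -> : \sum_(i < N) Num.conj (P i j) * P i j = (1%:M : 'M[R[i]]_N) j j.
      by rewrite -PP' mxE; apply: eq_bigr => i _; rewrite !mxE.
    by rewrite mxE eqxx mul1r.
  rewrite -scaler_suml -mulr_suml.
  have -> : \sum_(i < N) Num.conj (P i j) * P i m = (1%:M : 'M[R[i]]_N) j m.
    by rewrite -PP' mxE; apply: eq_bigr => i _; rewrite !mxE.
  by rewrite mxE eq_sym (negPf mj) mul0r scale0r.
- move=> k l /andP[kl lN]; have kN := ltn_trans kl lN.
  have /is_trig_mxP/(_ (Ordinal kN) (Ordinal lN) kl) := trigE.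
  rewrite mxE => <-; have := ip_wr (T (w k)) (Ordinal lN); rewrite /= => ->.
  apply: eq_bigr => m _; rewrite !mxE mulrC; congr (_ * _).
  have -> : w k = w (Ordinal kN) by [].
  rewrite wE (op_sum lT) ip_suml; apply: eq_bigr => j _.
  by rewrite (opZ lT) ipZl mxE.
Qed.

(** A diagonal entry a of a triangular matrix is an eigenvalue of the compression. Its eigenvector x
    has T x - a x within the compression error, so |a| >= e would force x = 0. *)
Lemma triangular_diagonal_small T N w (d e : R) : linear T -> orthonormal_upto N w ->
  (forall k l, (k < l < N)%N -> ip (T (w k)) (w l) = 0) ->
  (forall x, rnorm (T x - ortho_proj w N (T x)) <= d * rnorm x) ->
  (forall (a : R[i]) x, e <= modulus a -> rnorm (T x - a *: x) <= d * rnorm x -> x = 0) ->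
  forall k, (k < N)%N -> modulus (ip (T (w k)) (w k)) < e.
Proof.
move=> lT ow trig hd he k kN; rewrite ltNge; apply/negP => ek.
set a := ip (T (w k)) (w k) in ek.
pose A : 'M[R[i]]_N := \matrix_(i, j) ip (T (w i)) (w j).
have /det0P[c c0 cA] : \det (A - a%:M) == 0.
  rewrite det_trig.
    rewrite (bigD1 (Ordinal kN)) //= !mxE /= eqxx mulr1n subrr mul0r //.
  apply/is_trig_mxP => i j ij; rewrite !mxE -val_eqE (ltn_eqF ij) mulr0n subr0.
  by rewrite trig // ij ltn_ord.
pose x := \sum_(i < N) c 0 i *: w i.
have xw (j : 'I_N) : ip x (w j) = c 0 j.
  rewrite ip_suml (bigD1 j) //= big1 => [|i ij].
    by rewrite ipZl ow eqxx ltn_ord mulr1 addr0.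
  by rewrite ipZl ow (negPf (_ : (i : nat) != j)) ?mulr0.
have projTx : ortho_proj w N (T x) = a *: x.
  rewrite /ortho_proj /x scaler_sumr; apply: eq_bigr => j _; rewrite scalerA; congr (_ *: _).
  rewrite (op_sum lT) ip_suml; move/rowP/(_ j): cA; rewrite mulmxBr mul_mx_scalar !mxE => /eqP.
  rewrite subr_eq0 => /eqP <-; apply: eq_bigr => i _.
  by rewrite (opZ lT) ipZl mxE.
have x0 : x = 0 by apply: (he a) => //; rewrite -projTx.
by move/eqP: c0; apply; apply/rowP => j; rewrite -xw x0 ip0l mxE.
Qed.

End VolterraCompression.

(** * The eigenvalues of the real part *)

Lemma sum_square_split (V : zmodType) (f : nat -> nat -> V) (N : nat) :
  \sum_(0 <= k < N) \sum_(0 <= l < N) f k l =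
  \sum_(0 <= k < N) f k k + \sum_(0 <= k < N) \sum_(k.+1 <= l < N) f k l
   + \sum_(0 <= k < N) \sum_(k.+1 <= l < N) f l k.
Proof.
have triS (g : nat -> nat -> V) n : \sum_(0 <= k < n.+1) \sum_(k.+1 <= l < n.+1) g k l =
    \sum_(0 <= k < n) \sum_(k.+1 <= l < n) g k l + \sum_(0 <= k < n) g k n.
  rewrite big_nat_recr //= [X in _ + X]big_geq // addr0 -big_split /=.
  by apply: eq_big_nat => k /andP[_ kn]; rewrite big_nat_recr.
elim: N => [|N IH]; first by rewrite !big_geq // !addr0.
rewrite !triS big_nat_recr //= [X in _ + X]big_nat_recr //= [X in _ = X + _ + _]big_nat_recr //=.
under eq_big_nat => k kN do rewrite big_nat_recr //=.
rewrite big_split /= IH -!addrA; congr (_ + _).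
by rewrite !addrA [LHS](GRing.add.[ACl 5*1*3*2*4]).
Qed.

Section MainEstimate.
Context (R : realType) (H : completeNormedModType R[i]).
Context (ip : {dot H for (@Num.conj R[i])}).
Hypothesis hip : hilbert ip.
Implicit Types (v w u : nat -> H) (x y e : H).

Lemma rnorm_ortho_le1 v k : orthosystem ip v -> rnorm (v k) <= 1.
Proof.
move=> ov; rewrite -(@ler_pXn2r _ 2) ?nnegrE ?rnorm_ge0 // expr1n -lecR -(ipxx hip) ov eqxx /=.
by case: (v k != 0); rewrite ?lexx // ler01.
Qed.

Lemma rnorm_ortho_sum v (c : nat -> R[i]) (a b : nat) : orthosystem ip v ->
  rnorm (\sum_(a <= k < b) c k *: v k) ^+ 2 <= mass a b c.
Proof.
move=> ov; rewrite /mass; elim: b => [|b IH]; first by rewrite !big_geq // rnorm0 expr0n.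
have [ba|ab] := ltnP b a; first by rewrite !big_geq // rnorm0 expr0n.
rewrite !big_nat_recr //= (rnormD2 hip) ip_suml [X in complex.Re X]big_nat [X in complex.Re X]big1 => [|k /andP[_ kb]].
  rewrite /= mulr0 addr0 lerD // rnormZ exprMn ler_piMr ?sqr_ge0 //.
  by rewrite expr_le1 ?rnorm_ge0 // rnorm_ortho_le1.
by rewrite ipZl ipZr ov ltn_eqF //= !mulr0.
Qed.

Lemma mass_bessel v x N : orthosystem ip v ->
  mass 0 N (fun k => ip x (v k)) <= rnorm x ^+ 2.
Proof. by move=> ov; rewrite /mass big_mkord bessel. Qed.

Lemma mass_conj (z : nat -> R[i]) a b : mass a b (fun k => Num.conj (z k)) = mass a b z.
Proof. by apply: eq_bigr => k _; rewrite modulus_conj. Qed.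

(** Up to conjugation the sums are the coefficients in [p] of a single combination of the [w k]. *)
Lemma bessel_family_ortho (p w : nat -> H) (n : nat) : orthosystem ip p -> orthosystem ip w ->
  bessel_family n (fun i k => ip (p i) (w k)).
Proof.
move=> op ow z a b; apply: (@le_trans _ _ (rnorm (\sum_(a <= k < b) Num.conj (z k) *: w k) ^+ 2)).
  apply: le_trans (bessel hip _ n op); apply: ler_sum => i _.
  rewrite -modulus_conj (_ : Num.conj _ = ip (\sum_(a <= k < b) Num.conj (z k) *: w k) (p i)) //.
  rewrite ip_suml rmorph_sum; apply: eq_bigr => k _.
  by rewrite ipZl rmorphM /= (ipC ip).
by apply: (le_trans (rnorm_ortho_sum _ _ _ ow)); rewrite mass_conj.
Qed.

Lemma bessel_family_conj n (E : nat -> nat -> R[i]) :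
  bessel_family n E -> bessel_family n (fun i k => Num.conj (E i k)).
Proof.
move=> hE z a b; rewrite -mass_conj; apply: le_trans (hE _ a b).
apply: ler_sum => i _; rewrite -modulus_conj rmorph_sum /=.
by under eq_bigr do rewrite rmorphM /= conjCK.
Qed.

Lemma selfadjoint_linear (J : H -> H) : selfadjoint ip J -> linear J.
Proof.
move=> sJ a x y; apply: (ip_inj hip) => z.
by rewrite -(sJ z) !ipDr !ipZr !(sJ z).
Qed.

(** * Truncation of the leading eigenvalues and of the remainder *)

Section Rest.
Context (J : H -> H) (u : nat -> H) (lam : nat -> R) (m : nat) (q : R).
Hypotheses (cJ : compact_op J) (sJ : selfadjoint ip J) (eJ : eigen_expansion ip J u lam).
Hypotheses (q0 : 0 <= q) (hq : forall M, \sum_(m <= j < M) `|lam j| ^+ 2 <= q ^+ 2).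

Let ou := expansion_ortho eJ.

Let rest M x := J x - \sum_(j < M) ((lam j)%:C * ip x (u j)) *: u j.

Lemma ip_eigen x j : ip (J x) (u j) = (lam j)%:C * ip x (u j).
Proof. by rewrite sJ (expansion_eigen eJ) ipZr conj_real. Qed.

Lemma rest_rnorm2 M x : rnorm (rest M x) ^+ 2 =
  rnorm (J x) ^+ 2 - \sum_(j < M) `|lam j| ^+ 2 * modulus (ip x (u j)) ^+ 2.
Proof.
have -> : rest M x = J x - \sum_(j < M) ip (J x) (u j) *: u j.
  by congr (_ - _); apply: eq_bigr => j _; rewrite ip_eigen.
rewrite rnorm_sub_projs2 //; congr (_ - _); apply: eq_bigr => j _.
by rewrite ip_eigen modulusM modulus_real exprMn.
Qed.

(** The Hilbert-Schmidt norm passes from [u] to [v] by exchanging sums and applying Bessel's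
    inequality to each [u j]. The expansion is cut at an [M] for which the [N] errors amount to at
    most [d]. *)
Lemma rest_hilbert_schmidt v N : orthosystem ip v ->
  \sum_(0 <= k < N) rnorm (rest m (v k)) ^+ 2 <= q ^+ 2.
Proof.
move=> ov; apply/ler_addgt0Pr => d d0.
have min0 : 0 < Num.min 1 (d / N.+1%:R) by rewrite lt_min ltr01 divr_gt0 ?ltr0n.
have [M0 hM0] := expansion_lim eJ min0.
pose M := maxn m M0.
have lamM : `|lam M| ^+ 2 * N%:R <= d.
  have h1 : `|lam M| <= `|lam M0| by apply: (expansion_homo eJ); rewrite leq_maxr.
  move: hM0; rewrite lt_min => /andP[h2 h3].
  have h4 : `|lam M| ^+ 2 <= d / N.+1%:R.
    rewrite expr2 (@le_trans _ _ (`|lam M| * 1)) //.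
      by rewrite ler_wpM2l // (le_trans h1) // ltW.
    by rewrite mulr1 (le_trans h1) // ltW.
  rewrite (@le_trans _ _ (d / N.+1%:R * N%:R)) // ?ler_wpM2r //.
  by rewrite mulrAC ler_pdivrMr ?ltr0n // ler_wpM2l ?(ltW d0) // ler_nat.
have key k : rnorm (rest m (v k)) ^+ 2 <=
    `|lam M| ^+ 2 + \sum_(m <= j < M) `|lam j| ^+ 2 * modulus (ip (v k) (u j)) ^+ 2.
  have := rest_rnorm2 m (v k); have := rest_rnorm2 M (v k).
  rewrite -!(big_mkord xpredT (fun j => `|lam j| ^+ 2 * modulus (ip (v k) (u j)) ^+ 2)).
  rewrite (@big_cat_nat _ _ _ m 0 M) //= ?leq_maxl // => h1 ->.
  have h2 : rnorm (rest M (v k)) ^+ 2 <= `|lam M| ^+ 2.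
    rewrite ler_pXn2r ?nnegrE ?rnorm_ge0 // (le_trans (expansion_rest eJ M (v k))) //.
    by rewrite ler_piMr // rnorm_ortho_le1.
  by move: h1 h2; lra.
apply: (le_trans (ler_sum _ (fun k _ => key k))).
rewrite big_split /= big_const_nat iter_addr addr0 subn0 -mulr_natr addrC.
apply: lerD lamM; rewrite exchange_big /=; apply: le_trans (hq M).
apply: ler_sum => j _; rewrite -big_distrr /= ler_piMr ?sqr_ge0 //.
apply: (@le_trans _ _ (mass 0 N (fun k => ip (u j) (v k)))).
  by apply: ler_sum => k _; rewrite -(ipC ip) modulus_conj.
apply: (le_trans (mass_bessel _ _ ov)).
by rewrite expr_le1 ?rnorm_ge0 // rnorm_ortho_le1.
Qed.

(** In Hilbert-Schmidt norm truncation costs nothing: the inner sum pairs the image of [w k] with a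
    vector of norm at most one, and Cauchy-Schwarz in [k] does the rest. *)
Lemma tri_rest_le w N e : orthosystem ip w -> rnorm e <= 1 ->
  modulus (\sum_(0 <= k < N) ip e (w k) *
    \sum_(k.+1 <= l < N) Num.conj (ip e (w l)) * ip (rest m (w k)) (w l)) <= q.
Proof.
move=> ow ne; apply: le_trans (modulus_sum _ _ _) _.
have me : mass 0 N (fun k => ip e (w k)) <= 1.
  by apply: (le_trans (mass_bessel _ _ ow)); rewrite expr_le1 ?rnorm_ge0.
have h k : modulus (\sum_(k.+1 <= l < N) Num.conj (ip e (w l)) * ip (rest m (w k)) (w l)) <=
    rnorm (rest m (w k)).
  have -> : \sum_(k.+1 <= l < N) Num.conj (ip e (w l)) * ip (rest m (w k)) (w l) =
      ip (rest m (w k)) (\sum_(k.+1 <= l < N) ip e (w l) *: w l).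
    by rewrite ip_sumr; apply: eq_bigr => l _; rewrite ipZr.
  apply: le_trans (cauchy_schwarz hip _ _) _; rewrite ler_piMr ?rnorm_ge0 //.
  rewrite -(@ler_pXn2r _ 2) ?nnegrE ?rnorm_ge0 // expr1n.
  apply: (le_trans (rnorm_ortho_sum _ _ _ ow)); apply: le_trans me.
  have [kN|Nk] := leqP k.+1 N; last by rewrite /mass big_geq ?mass_ge0 // ltnW.
  by rewrite /mass (@big_cat_nat _ _ _ k.+1 0 N) //= lerDr mass_ge0.
apply: (@le_trans _ _ (\sum_(0 <= k < N) modulus (ip e (w k)) * rnorm (rest m (w k)))).
  by apply: ler_sum => k _; rewrite modulusM ler_wpM2l ?modulus_ge0.
rewrite -(@ler_pXn2r _ 2) ?nnegrE ?sumr_ge0 // => [|k _]; last first.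
  by rewrite mulr_ge0 ?modulus_ge0 ?rnorm_ge0.
apply: le_trans (sum_cauchy_schwarz _ _ _) _.
apply: le_trans (_ : 1 * q ^+ 2 <= _); last by rewrite mul1r.
apply: ler_pM => //; try by rewrite sumr_ge0 // => k _; rewrite sqr_ge0.
exact: rest_hilbert_schmidt.
Qed.

Lemma tri_expansion_le w N e : orthosystem ip w -> rnorm e <= 1 ->
  modulus (\sum_(0 <= k < N) ip e (w k) *
    \sum_(k.+1 <= l < N) Num.conj (ip e (w l)) * ip (J (w k)) (w l)) <=
  \sum_(j < m) `|lam j| * modulus (tri 0 N (fun k => ip (w k) (u j) * ip e (w k))
    (fun l => ip (u j) (w l) * Num.conj (ip e (w l)))) + q.
Proof.
move=> ow ne.
have -> : \sum_(0 <= k < N) ip e (w k) *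
    \sum_(k.+1 <= l < N) Num.conj (ip e (w l)) * ip (J (w k)) (w l) =
  \sum_(j < m) (lam j)%:C * tri 0 N (fun k => ip (w k) (u j) * ip e (w k))
    (fun l => ip (u j) (w l) * Num.conj (ip e (w l))) +
  \sum_(0 <= k < N) ip e (w k) *
    \sum_(k.+1 <= l < N) Num.conj (ip e (w l)) * ip (rest m (w k)) (w l).
  rewrite /tri; under [X in _ = X + _]eq_bigr do rewrite mulr_sumr.
  rewrite exchange_big -big_split /=; apply: eq_bigr => k _.
  have -> : \sum_(j < m) (lam j)%:C * (ip (w k) (u j) * ip e (w k) *
       \sum_(k.+1 <= l < N) ip (u j) (w l) * Num.conj (ip e (w l))) =
     ip e (w k) * \sum_(k.+1 <= l < N) \sum_(j < m)
        Num.conj (ip e (w l)) * ((lam j)%:C * ip (w k) (u j) * ip (u j) (w l)).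
    rewrite exchange_big mulr_sumr /=; apply: eq_bigr => j _.
    rewrite !mulr_sumr; apply: eq_bigr => l _; ring.
  rewrite -mulrDr -big_split /=; congr (_ * _); apply: eq_bigr => l _.
  rewrite -mulr_sumr -mulrDr /rest ipBl ip_suml; congr (_ * _).
  under [X in _ = _ + (_ - X)]eq_bigr do rewrite ipZl.
  by rewrite addrC subrK.
apply: le_trans (modulusD _ _) _; apply: lerD; last exact: tri_rest_le.
apply: le_trans (modulus_sum _ _ _) _; apply: ler_sum => j _.
by rewrite modulusM modulus_real.
Qed.

End Rest.

(** For k < l the entry of [T] vanishes, so the entry of its real part is -i times that of its
    imaginary part; the entries with k > l are conjugate to these. The diagonal consists of real
    parts of numbers bounded by [d]. *)
Lemma real_part_form_le T w N e (d : R) : bounded_op T -> orthosystem ip w ->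
  ortho_proj ip w N e = e -> rnorm e <= 1 ->
  (forall k l, (k < l < N)%N -> ip (T (w k)) (w l) = 0) ->
  (forall k, (k < N)%N -> modulus (ip (T (w k)) (w k)) <= d) -> 0 <= d ->
  modulus (ip (real_part ip T e) e) <= d + 2 *
   modulus (\sum_(0 <= k < N) ip e (w k) *
    \sum_(k.+1 <= l < N) Num.conj (ip e (w l)) * ip (imag_part ip T (w k)) (w l)).
Proof.
move=> bT ow pe ne trig diag d0.
pose U := real_part ip T; pose J := imag_part ip T.
have sU : selfadjoint ip U := real_part_selfadjoint hip bT.
have aT' x y : ip (adjoint ip T x) y = ip x (T y).
  by rewrite -(ipC ip) -(adjointP hip bT) (ipC ip).
have lU : linear U := selfadjoint_linear sU.
pose E k := ip e (w k).
pose f k l := E k * Num.conj (E l) * ip (U (w k)) (w l).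
have UE : ip (U e) e = \sum_(0 <= k < N) \sum_(0 <= l < N) f k l.
  rewrite -{1 2}pe /ortho_proj (op_sum lU) ip_suml big_mkord; apply: eq_bigr => k _.
  rewrite (opZ lU) ipZl ip_sumr big_mkord mulr_sumr; apply: eq_bigr => l _.
  by rewrite ipZr mulrA.
pose Z := \sum_(0 <= k < N) E k *
    \sum_(k.+1 <= l < N) Num.conj (E l) * ip (J (w k)) (w l).
rewrite UE sum_square_split.
have -> : \sum_(0 <= k < N) \sum_(k.+1 <= l < N) f k l = - 'i%R * Z.
  rewrite /Z mulr_sumr; apply: eq_big_nat => k _; rewrite mulrCA !mulr_sumr.
  apply: eq_big_nat => l /andP[kl lN].
  rewrite /f /U real_partE ipBl ipZl trig ?kl ?lN // sub0r -/J; ring.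
have -> : \sum_(0 <= k < N) \sum_(k.+1 <= l < N) f l k = Num.conj (- 'i%R * Z).
  rewrite /Z !rmorphM rmorph_sum /= mulr_sumr; apply: eq_big_nat => k _.
  rewrite rmorphM /= rmorph_sum mulrCA !mulr_sumr.
  apply: eq_big_nat => l /andP[kl lN].
  rewrite /f sU -(ipC ip) /U real_partE ipBl ipZl trig ?kl ?lN // sub0r -/J.
  rewrite rmorphN !rmorphM /= conjCK; ring.
apply: le_trans (modulusD _ _) _; rewrite modulus_conj.
apply: le_trans (lerD (modulusD _ _) (lexx _)) _.
rewrite modulusM modulusN modulus_i mul1r -addrA -mulr2n -[modulus _ *+ 2]mulr_natl lerD //.
apply: le_trans (modulus_sum _ _ _) _.
apply: (@le_trans _ _ (\sum_(0 <= k < N) modulus (E k) ^+ 2 * d)).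
  apply: ler_sum_nat => k /andP[_ kN]; rewrite /f modulusK modulusM modulus_real.
  rewrite ger0_norm ?sqr_ge0 // ler_wpM2l ?sqr_ge0 //; apply: le_trans (diag k kN).
  rewrite /U /real_part ipZl ipDl aT' -(ipC ip (w k)) modulusM modulusV.
  rewrite -(rmorph_nat (real_complex R)) modulus_real normr_nat mulrC ler_pdivrMr //.
  by apply: le_trans (modulusD _ _) _; rewrite modulus_conj mulr_natr mulr2n.
rewrite -mulr_suml ler_piMl // (le_trans (mass_bessel e N ow)) //.
by rewrite expr_le1 ?rnorm_ge0.
Qed.

(** The number [L] of halvings and the cut [m] stay free; logarithm and fourth power appear only
    when they are chosen. *)
Lemma real_part_eigenvalues_le T (u p : nat -> H) (lam mu : nat -> R) (m n L : nat) (q : R) :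
  compact_op T -> (forall a x, a != 0 -> T x = a *: x -> x = 0) ->
  eigen_expansion ip (imag_part ip T) u lam -> compact_op (imag_part ip T) ->
  eigen_expansion ip (real_part ip T) p mu ->
  0 <= q -> (forall M, \sum_(m <= j < M) `|lam j| ^+ 2 <= q ^+ 2) ->
  \sum_(i < n) `|mu i| <=
   4 * (L%:R + 2 * n%:R / 2 ^+ L) * \sum_(j < m) `|lam j| + 2 * n%:R * q.
Proof.
move=> cT noeig eJ cJ eU q0 hq; have [bT _] := cT; have [lT _] := bT.
have sJ := imag_part_selfadjoint hip bT.
have ou := expansion_ortho eJ; have op := expansion_ortho eU.
apply/ler_addgt0Pr => d d0.
(* The [n] diagonal errors of this size add up to at most [d]. *)
have dn0 : 0 < d / n.+1%:R by rewrite divr_gt0 ?ltr0n.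
have [g g0 hg] := approximate_eigenvalue hip cT noeig dn0.
have [N [v [ov pv hv]]] := compact_op_compression hip n p cT g0.
have [w [onw projE trig]] := orthonormal_upto_triangular lT ov.
have ow := orthonormal_ortho hip onw.
have diag : forall k, (k < N)%N -> modulus (ip (T (w k)) (w k)) <= d / n.+1%:R.
  move=> k kN; apply/ltW; apply: (triangular_diagonal_small (d := g) lT onw trig) => // x.
  by rewrite projE.
have np i : rnorm (p i) <= 1 by exact: rnorm_ortho_le1.
pose Z i j := tri 0 N (fun k => ip (w k) (u j) * ip (p i) (w k))
    (fun l => ip (u j) (w l) * Num.conj (ip (p i) (w l))).
have key (i : 'I_n) : `|mu i| <= d / n.+1%:R + 2 * (\sum_(j < m) `|lam j| * modulus (Z i j) + q).
  have -> : `|mu i| = modulus (ip (real_part ip T (p i)) (p i)).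
    rewrite (expansion_eigen eU) ipZl modulusM modulus_real op eqxx /=.
    have [pi0|_] := eqVneq (p i) 0; last by rewrite modulus1 mulr1.
    rewrite modulus0 mulr0; apply/eqP; rewrite normr_eq0; apply: contraT.
    by move/(expansion_neq0 eU); rewrite pi0 eqxx.
  apply: le_trans (real_part_form_le bT ow _ (np i) trig diag (ltW dn0)) _.
    by rewrite projE pv.
  by rewrite lerD2l ler_wpM2l // tri_expansion_le.
apply: (le_trans (ler_sum _ (fun i _ => key i))).
rewrite big_split /= sumr_const card_ord -mulr_sumr big_split /= sumr_const card_ord.
rewrite exchange_big /=.
(* The two masses of [u j] sum to at most 2, those of the [n] vectors [p i] to at most 2n. *)
have hZ (j : 'I_m) : \sum_(i < n) `|lam j| * modulus (Z i j) <=
    `|lam j| * (2 * (L%:R + 2 * n%:R / 2 ^+ L)).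
  rewrite -mulr_sumr ler_wpM2l //.
  have bF := @bessel_family_ortho p w n op ow.
  apply: le_trans (tri_bessel_le _ _ (bessel_family_conj bF) bF L 0 N) _.
  have u1 : rnorm (u j) ^+ 2 <= 1 by rewrite expr_le1 ?rnorm_ge0 // rnorm_ortho_le1.
  have m1 : mass 0 N (fun l => ip (u j) (w l)) <= 1.
    by apply: le_trans (mass_bessel _ _ ow) _.
  have m2 : mass 0 N (fun k => ip (w k) (u j)) <= 1.
    rewrite -mass_conj; apply: le_trans m1; rewrite le_eqVlt; apply/orP; left; apply/eqP.
    by apply: eq_bigr => k _; rewrite (ipC ip).
  have p1 i : mass 0 N (fun l => ip (p i) (w l)) <= 1.
    by apply: le_trans (mass_bessel _ _ ow) _; rewrite expr_le1 ?rnorm_ge0.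
  apply: ler_pM.
  - by rewrite addr_ge0 ?mass_ge0.
  - rewrite addr_ge0 ?ler0n // divr_ge0 ?exprn_ge0 // sumr_ge0 // => i _.
    by rewrite addr_ge0 ?mass_ge0.
  - by lra.
  - rewrite lerD2l ler_wpM2r ?invr_ge0 ?exprn_ge0 //.
    rewrite mulr_natr -[in leRHS](card_ord n) -sumr_const; apply: ler_sum => i _.
    by rewrite mass_conj; have := p1 i; lra.
have hs : \sum_(j < m) \sum_(i < n) `|lam j| * modulus (Z i j) <=
    \sum_(j < m) `|lam j| * (2 * (L%:R + 2 * n%:R / 2 ^+ L)).
  by apply: ler_sum => j _; exact: hZ.
rewrite -mulr_suml in hs.
have hd : d / n.+1%:R *+ n <= d.
  by rewrite -mulr_natr mulrAC ler_pdivrMr ?ltr0n // ler_wpM2l ?(ltW d0) // ler_nat.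
rewrite -[q *+ n]mulr_natr.
move: hs hd; move: (\sum_(j < m) \sum_(i < n) _) (\sum_(j < m) `|lam j|) (d / _ *+ n).
move: (L%:R + 2 * n%:R / 2 ^+ L) => a b c z; nra.
Qed.

End MainEstimate.

Section LogBound.
Context (R : realType).

(** With L the integer part of log_2 n, the quotient is at most 4, and L <= 2 ln n because ln 2 >=
    1/2. *)
Lemma ln_bound (n : nat) : (0 < n)%N -> exists L : nat,
  L%:R + 2 * n%:R / 2 ^+ L <= 4 * ln (expR 1 * n%:R) :> R.
Proof.
move=> n0; exists (trunc_log 2 n); set L := trunc_log 2 n.
have h1 : (2 ^ L <= n)%N by exact: trunc_logP.
have h2 : (n < 2 ^ L.+1)%N by exact: trunc_log_ltn.
have k1 : 2 * n%:R / 2 ^+ L <= 4 :> R.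
  rewrite ler_pdivrMr ?exprn_gt0 // (_ : 4 * 2 ^+ L = 2 * (2 * 2 ^+ L)); last by ring.
  by rewrite ler_wpM2l // -exprS -natrX ler_nat ltnW.
have ln2 : 2^-1 <= ln 2 :> R.
  have := @le_ln1Dx R (- 2^-1); rewrite (_ : 1 - 2^-1 = 2^-1); last by field.
  by rewrite lnV ?posrE // lerN2; apply; rewrite ltrN2 invf_lt1 // ltr1n.
have k2 : L%:R / 2 <= ln (n%:R) :> R.
  apply: le_trans (_ : ln (2 ^+ L) <= _); last first.
    by rewrite ler_ln ?posrE ?exprn_gt0 ?ltr0n // -natrX ler_nat.
  by rewrite lnXn // -[ln 2 *+ L]mulr_natl ler_wpM2l ?ler0n.
rewrite lnM ?posrE ?expR_gt0 ?ltr0n // expRK; move: k1 k2.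
move: (2 * n%:R / _) (ln n%:R) => a b; have : 0 <= L%:R :> R by []; lra.
Qed.

End LogBound.

(** * Choice of the parameters and conclusion *)

Theorem theorem11 (R : realType) (H : completeNormedModType R[i])
  (ip : {dot H for (@Num.conj R[i])}) (X : symm_normed_ideal ip)
  (F : banach_seq_lattice R) (T : H -> H) :
  hilbert ip -> separable H ->
  norm_equiv_ssum F X ->
  square_sampling_bounded F ->
  volterra T ->
  in_ideal X (imag_part ip T) ->
  in_log_ideal F ip (real_part ip T).
Proof.
move=> hip _ [c [C [c0 _ equiv]]] bounded vol [t _ Jt].
have cT := vol.1; have [bT _] := cT.
have noeig a x : a != 0 -> T x = a *: x -> x = 0 by exact: volterra_eigen0 vol.
have cJ : compact_op (imag_part ip T) by rewrite -Jt; exact: sni_compact.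
have cU : compact_op (real_part ip T).
  rewrite (_ : real_part ip T = fun x => T x - 'i%R *: imag_part ip T x).
    exact: compact_op_sub.
  by apply/funext => x; exact: real_partE.
have sJ := imag_part_selfadjoint hip bT; have sU := real_part_selfadjoint hip bT.
have [u [lam eJ]] := eigen_expansion_exists hip cJ sJ.
have [p [mu eU]] := eigen_expansion_exists hip cU sU.
have sumJ k : ssum ip (imag_part ip T) k = \sum_(j < k.+1) `|lam j|.
  by rewrite /ssum (snumber_expansion hip cJ sJ eJ).
have sumU k : ssum ip (real_part ip T) k = \sum_(j < k.+1) `|mu j|.
  by rewrite /ssum (snumber_expansion hip cU sU eU).
(* As c > 0 and the norm of [t] is finite, the partial sums have finite norm in [F]. *)
have [f fE] : exists f, bsl_seq F f = ssum ip (imag_part ip T).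
  apply: seq_norm_fin; have /andP[+ _] := equiv t; rewrite Jt.
  case: (seq_norm _ _) => [r||] //; first by rewrite ltry.
  by rewrite mulry gtr0_sg // mul1e leye_eq.
have [B B0 hB] := @tail_bound R F bounded (fun j => `|lam j|) f
  (fun j => normr_ge0 _) (expansion_homo eJ) (etrans fE (funext sumJ)).
(* The factors 4 of [real_part_eigenvalues_le] and of [ln_bound] make 16; the tail contributes
   [2 * B]. *)
split=> //; apply: (@log_domination R F bounded (ssum ip (imag_part ip T)) _ f (16 + 2 * B)) => //.
- by rewrite addr_ge0 // mulr_ge0.
- by move=> k; rewrite sumU sumr_ge0.
move=> k; rewrite sumU sumJ prednK ?expn_gt0 //.
have [L hL] := @ln_bound R k.+1 (ltn0Sn k).
(* For n = k+1 this turns the tail term 2nq into a multiple of [|lam 0|] independent of n. *)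
pose q := B * `|lam 0%N| / k.+1%:R.
have q0 : 0 <= q by rewrite divr_ge0 ?mulr_ge0.
have hq M : \sum_((k.+1 ^ 4)%N <= j < M) `|lam j| ^+ 2 <= q ^+ 2.
  rewrite /q expr_div_n ler_pdivlMr ?exprn_gt0 ?ltr0n // mulrC; exact: hB.
apply: le_trans (real_part_eigenvalues_le hip k.+1 L cT noeig eJ cJ eU q0 hq) _.
have -> : 2 * k.+1%:R * q = 2 * B * `|lam 0%N|.
  rewrite /q; have : k.+1%:R != 0 :> R by rewrite pnatr_eq0.
  by move: k.+1%:R => x x0; field.
(* The tail term is absorbed: [|lam 0|] is at most [S], and the logarithm is at least one. *)
set S := \sum_(j < _) _; have S0 : `|lam 0%N| <= S.
  rewrite /S -(big_mkord xpredT (fun j => `|lam j|)) big_ltn ?expn_gt0 //.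
  by rewrite lerDl sumr_ge0.
have l1 : 1 <= ln (expR 1 * k.+1%:R) :> R.
  by rewrite lnM ?posrE ?expR_gt0 ?ltr0n // expRK lerDl ln_ge0 // ler1n.
have := normr_ge0 (lam 0%N); move: hL S0 l1.
move: (L%:R + _) (ln _) `|lam 0%N| => a l s0 hL sS l1 s00.
have SS : 0 <= S by apply: le_trans sS.
have h1 : 4 * a * S <= 16 * l * S by rewrite ler_wpM2r //; lra.
have h2 : 2 * B * s0 <= 2 * B * (l * S).
  by rewrite ler_wpM2l ?mulr_ge0 // (le_trans sS) // ler_peMl.
by rewrite !mulrDl; lra.
Qed.
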